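(* Let $1\le r<p\le q<\infty$, let $Q\in(0,\infty)$ and $\alpha\in(0,r)\cap(0,Q)$ be such that $1<p/r\le q/r<Q/\alpha<\infty$, and let $X$ be an Ahlfors $Q$-regular metric measure space supporting a weak $(1,r)$-Poincaré inequality. Then there exists a positive constant $C$ such that, for all functions $f\in NM_p^q(X)$, all upper gradients $\rho$ of $f$ and all $R\in(0,\infty)$, $$\left\|f-f_{B(\cdot,R)}\right\|_{\mathcal{M}_{Q^*p}^{Q^*q}(X)}\le C R^{1-\alpha/r}\|\rho\|_{\mathcal{M}_p^q(X)},$$ where $Q^*:=\frac{Qr}{Qr-q\alpha}$ and $f-f_{B(\cdot,R)}$ denotes the function $x\mapsto f(x)-\frac1{\mu(B(x,R))}\int_{B(x,R)}f\,d\mu$.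
   Context: Throughout, $(X,d,\mu)$ is a metric space with a non-trivial Borel regular measure $\mu$ which is finite on bounded sets and positive on (non-empty) open sets; $\tau B$ is the ball with the same center as $B$ and $\tau$ times its radius. $X$ is Ahlfors $Q$-regular if there is a constant $C\ge1$ with $C^{-1}r^Q\le\mu(B(x,r))\le Cr^Q$ for all $x\in X$ and all $r\in(0,2\,\mathrm{diam}(X))$. Morrey space: for $1\le p\le q<\infty$, $\mathcal{M}_p^q(X)$ is the space of all measurable functions $f$ on $X$ with $$\|f\|_{\mathcal{M}_p^q(X)}:=\sup_{B\subset X}[\mu(B)]^{1/q-1/p}\left[\int_B|f(x)|^p\,d\mu(x)\right]^{1/p}<\infty,$$ the supremum being over all balls $B$ in $X$. Curves: a curve is a continuous mapping from an interval into $X$; it is rectifiable if its length is finite; rectifiable curves are always arc-length parameterized, and $l(\gamma)$ denotes the length of $\gamma$. For a family $\Gamma$ of rectifiable curves, $F(\Gamma)$ is the set of Borel measurable functions $\rho:X\to[0,\infty]$ with $\int_\gamma\rho\,ds\ge 1$ for all $\gamma\in\Gamma$ (so $F(\Gamma)=\emptyset$ if $\Gamma$ contains a constant curve). The Morrey-modulus is $\mathrm{Mod}_p^q(\Gamma):=\inf_{\rho\in F(\Gamma)}\|\rho\|_{\mathcal{M}_p^q(X)}^p$, with $\inf\emptyset=\infty$. A non-negative Borel function $g$ is an upper gradient of a measurable function $f$ if $$|f\circ\gamma(0)-f\circ\gamma(l(\gamma))|\le\int_\gamma g\,ds$$ for all non-constant rectifiable curves $\gamma$; it is a $\mathrm{Mod}_p^q$-weak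 upper gradient of $f$ if this inequality holds for all non-constant rectifiable curves except a family of Morrey-modulus zero. $\widetilde{NM_p^q}(X)$ is the set of measurable $f$ with $\|f\|_{\widetilde{NM_p^q}(X)}:=\|f\|_{\mathcal{M}_p^q(X)}+\inf\|g\|_{\mathcal{M}_p^q(X)}<\infty$, the infimum over all $\mathrm{Mod}_p^q$-weak upper gradients $g$ of $f$. The Newton-Morrey-Sobolev space $NM_p^q(X)$ is the quotient of $\widetilde{NM_p^q}(X)$ by $\{f:\|f\|_{\widetilde{NM_p^q}(X)}=0\}$, with the induced norm. $X$ supports a weak $(1,r)$-Poincaré inequality if there are constants $C>0$ and $\tau\ge1$ such that, for all open balls $B$ in $X$ and all functions $f,\rho$ on $\tau B$ with $\rho$ an upper gradient of $f$ in $\tau B$ and $f$ integrable on $B$, $$\frac1{\mu(B)}\int_B|f-f_B|\,d\mu\le C\,\mathrm{diam}(B)\left\{\frac1{\mu(\tau B)}\int_{\tau B}\rho^r\,d\mu\right\}^{1/r},\qquad f_B:=\frac1{\mu(B)}\int_Bf\,d\mu.$$ *)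

(* Defs.v *)
From HB Require Import structures.
From mathcomp Require Import all_boot all_order all_algebra.
From mathcomp Require Import all_classical all_reals all_analysis.
From mathcomp Require Import measurable_realfun.

Set Implicit Arguments.
Unset Strict Implicit.
Unset Printing Implicit Defensive.

Import Order.TTheory GRing.Theory Num.Theory.
Import numFieldNormedType.Exports.

Local Open Scope classical_set_scope.
Local Open Scope ring_scope.

(* Measurable types of the library are pointed. A metric space that carries a
   non-trivial measure is nonempty, so the base point loses no generality; it
   is never used. *)
#[short(type="pointedMetricType")]
HB.structure Definition PointedMetric (R : numDomainType) :=
  {T of Pointed T & Metric R T}.

Definition borel_type (T : topologicalType) := g_sigma_algebraType (@open T).

Section metric_measure_space.
Context {R : realType} {X : pointedMetricType R}.
Implicit Types (mu : {outer_measure set X -> \bar R}) (A : set X).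
Local Open Scope ereal_scope.

Definition borel_set A : Prop := <<s @open X >> A.

(* The diameter, +oo when unbounded and -oo for the empty set. *)
Definition ediam A : \bar R :=
  ereal_sup [set (mdist z.1 z.2)%:E | z in A `*` A].

(* As is usual in analysis on metric spaces, a Borel regular measure is an outer
   measure defined on all subsets. *)
Definition borel_regular mu : Prop :=
  (forall A, borel_set A -> mu.-caratheodory A) /\
  (forall A, exists B, [/\ borel_set B, A `<=` B & mu B = mu A]).

Definition metric_measure_space mu : Prop :=
  [/\ mu [set: X] != 0,
      borel_regular mu,
      (forall A, ediam A < +oo -> mu A < +oo) &
      (forall U, open U -> U !=set0 -> 0 < mu U)].

Definition ahlfors_regular mu (Q : R) : Prop :=
  exists2 C : R, (1 <= C)%R &
    forall (x : X) (s : R), (0 < s)%R -> s%:E < 2%:E * ediam [set: X] ->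
      (C^-1 * s `^ Q)%:E <= mu (ball x s) <= (C * s `^ Q)%:E.

(* [mu] as a measure on the sigma-algebra of its measurable sets. *)
Definition cara mu : {measure set (caratheodory_type mu) -> \bar R} :=
  [the {measure set _ -> \bar R} of (mu : set (caratheodory_type mu) -> \bar R)].

Definition mu_measurable_fun mu A (f : X -> R) : Prop :=
  measurable_fun (A : set (caratheodory_type mu)) f.

Definition borel_measurable_fun A (g : X -> \bar R) : Prop :=
  measurable_fun (A : set (borel_type X)) g.

(* The mean value f_A (real) and the mean of an extended-valued function; both
   are used for balls only, whose measure is positive and finite. *)
Definition mean mu A (f : X -> R) : R :=
  ((fine (mu A))^-1 * \int[cara mu]_(y in A) f y)%R.

Definition emean mu A (g : X -> \bar R) : \bar R :=
  (fine (mu A))^-1%:E * \int[cara mu]_(y in A) g y.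

End metric_measure_space.

Section curves.
Context {R : realType} {X : pointedMetricType R}.

Definition curve_length (a b : R) (gamma : R -> X) : \bar R :=
  ereal_sup [set (\sum_(0 <= k < size s)
      mdist (gamma (nth b (a :: s) k)) (gamma (nth b (a :: s) k.+1)))%:E
    | s in itv_partition a b].

(* An arc-length parameterized rectifiable curve on [0, arclen]; the values of
   [curve_fun] outside [0, arclen] are irrelevant. *)
Record rect_curve := RectCurve {
  arclen : R;
  curve_fun :> R -> X;
  arclen_ge0 : 0 <= arclen;
  curve_continuous : {within `[0, arclen], continuous curve_fun};
  curve_arc_length : forall t, t \in `[0, arclen] -> curve_length 0 t curve_fun = t%:E
}.

Definition curve_in (A : set X) (gamma : rect_curve) : Prop :=
  forall t, t \in `[0, arclen gamma] -> A (gamma t).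

Definition non_constant (gamma : rect_curve) : Prop :=
  exists2 t, t \in `[0, arclen gamma] & gamma t <> gamma 0.

Definition line_integral (gamma : rect_curve) (g : X -> \bar R) : \bar R :=
  (\int[@lebesgue_measure R]_(t in `[0%R, arclen gamma]) g (gamma t))%E.

End curves.
Arguments rect_curve {R} X.

Section morrey.
Context {R : realType} {X : pointedMetricType R}.
Variable mu : {outer_measure set X -> \bar R}.
Implicit Types (p q : R) (f : X -> R) (g rho : X -> \bar R).
Local Open Scope ereal_scope.

Definition morrey_norm p q g : \bar R :=
  ereal_sup [set mu (ball z.1 z.2) `^ (q^-1 - p^-1)
      * (\int[cara mu]_(y in ball z.1 z.2) `|g y| `^ p) `^ p^-1
    | z in [set z : X * R | (0 < z.2)%R]].

Definition admissible (Gamma : set (rect_curve X)) rho : Prop :=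
  [/\ borel_measurable_fun setT rho, (forall x, 0 <= rho x) &
      forall gamma, Gamma gamma -> 1 <= line_integral gamma rho].

Definition morrey_modulus p q (Gamma : set (rect_curve X)) : \bar R :=
  ereal_inf [set morrey_norm p q rho `^ p | rho in admissible Gamma].

Definition gradient_ineq f g (gamma : rect_curve X) : Prop :=
  `|f (gamma 0%R) - f (gamma (arclen gamma))|%:E <= line_integral gamma g.

(* [g] is an upper gradient of [f] in [A]; with [A = setT], in the whole space *)
Definition upper_gradient_in A f g : Prop :=
  [/\ mu_measurable_fun mu A f, borel_measurable_fun A g,
      (forall x, A x -> 0 <= g x) &
      forall gamma, non_constant gamma -> curve_in A gamma ->
        gradient_ineq f g gamma].

Definition weak_upper_gradient p q f g : Prop :=
  [/\ mu_measurable_fun mu setT f, borel_measurable_fun setT g,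
      (forall x, 0 <= g x) &
      exists2 Gamma : set (rect_curve X), morrey_modulus p q Gamma = 0 &
        forall gamma, non_constant gamma -> ~ Gamma gamma ->
          gradient_ineq f g gamma].

Definition pre_NM_norm p q f : \bar R :=
  morrey_norm p q (EFin \o f)
  + ereal_inf [set morrey_norm p q g | g in weak_upper_gradient p q f].

Definition pre_NM p q : set (X -> R) :=
  [set f | mu_measurable_fun mu setT f /\ pre_NM_norm p q f < +oo].

(* The class of [f] modulo the functions of zero norm, and the quotient space
   presented as the set of these classes. *)
Definition NM_class p q f : set (X -> R) :=
  [set h | pre_NM p q h /\ pre_NM_norm p q (h \- f)%R = 0].

Definition NM p q : set (set (X -> R)) := NM_class p q @` pre_NM p q.

Definition weak_poincare (r : R) : Prop :=
  exists C tau : R, [/\ (0 < C)%R, (1 <= tau)%R &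
    forall (x : X) (s : R) f rho, (0 < s)%R ->
      let B := ball x s in
      let tauB := ball x (tau * s) in
      upper_gradient_in tauB f rho ->
      (cara mu).-integrable B (EFin \o f) ->
      emean mu B (fun y => `|f y - mean mu B f|%:E)
        <= C%:E * ediam B * emean mu tauB (fun y => rho y `^ r) `^ r^-1].

End morrey.

(* Main.v *)
Require Import Defs.
From HB Require Import structures.
From mathcomp Require Import all_boot all_order all_algebra.
From mathcomp Require Import all_classical all_reals all_analysis.
From mathcomp Require Import measurable_realfun.
From mathcomp Require Import ring lra.

Set Implicit Arguments.
Unset Strict Implicit.
Unset Printing Implicit Defensive.

Import Order.TTheory GRing.Theory Num.Theory.
Import numFieldNormedType.Exports.

Local Open Scope classical_set_scope.
Local Open Scope ring_scope.

(** The function f is compared with its averages F_k(x) over the balls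
B(x, s / 2^k).  The averages converge to f almost everywhere, so
|f - F_0| <= sum_k |F_k - F_(k+1)|, and the Poincare inequality controls every
increment by the energy of the upper gradient rho near x:
|F_k - F_(k+1)|(x) <= c s_k E_k(x)^(1/p), where s_k = s / 2^k and E_k(x) is
s_k^(-Q) times the integral of rho^p over a ball of centre x and radius
comparable to s_k ([weak_poincare_energy], [ball_mean_near]).

Two bounds on E_k are interpolated.  Pointwise, the Morrey norm N of rho gives
E_k <= c N^p s_k^(-Q p / q).  In the mean over a ball of radius t, exchanging
the two integrals bounds the integral of E_k by c N^p t^(Q (1 - p / q)),
uniformly in k ([integral_energy_le]).  With
P = Qstar p, bounding E_k^Qstar by its supremum to the power Qstar - 1 times E_k
yields
  int_B |F_k - F_(k+1)|^P <= c N^P t^(Q (1 - p / q)) s_k^(P (1 - alpha / r)),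
the exponent Qstar being the one for which the powers match
([integral_halving_le]).  As alpha < r, the right-hand side decays geometrically
in k; a geometric weight therefore turns the sum over k of the increments into a
sum of their P-th powers ([telescope_powR_le]), which can be integrated term by
term ([integral_sub_mean_le]).  Multiplying by the power of mu(B) in the Morrey
norm cancels the power of t, which proves the theorem.

The convergence almost everywhere also comes from the Poincare inequality.  If
z is within s of x then |f(x) - F_s(x)| is at most |f(x) - F_2s(z)| plus a
multiple of the oscillation at z; averaging over z and exchanging the integrals
bounds the mean of |f - F_s| by the mean of the oscillation at scale 2 s, which
is O(s) ([integral_osc_le], [integral_osc_bound_le]).  Along s / 2^k these errors
are summable ([ball_mean_cvg_ae]).

Exchanging integrals over balls needs the set of pairs at distance less than s
to be measurable for the product of the sigma-algebras of mu-measurable sets.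
This holds because X is separable, which follows in turn from the finiteness of
mu on bounded sets and its positivity on balls ([measurable_dist_lt],
[tonelli_ball]). *)

(** * Geometric series and telescoping sums *)

Section series.
Context {R : realType}.
Implicit Types (a x l P : R) (u : nat -> R).

Lemma eseries_geometric_le a x : 0 <= a -> 0 < x -> x < 1 ->
  (\sum_(0 <= k <oo) (a * x ^+ k)%:E <= (a * (1 - x)^-1)%:E)%E.
Proof.
move=> a0 x0 x1; apply: lime_le.
  by apply: is_cvg_nneseries => k _ _; rewrite lee_fin mulr_ge0// exprn_ge0// ltW.
apply: nearW => n; rewrite sumEFin lee_fin.
by apply: geometric_le_lim => //; rewrite gtr0_norm.
Qed.

Lemma nneseries_term_le (v : nat -> \bar R) n : (forall k, (0 <= v k)%E) ->
  (v n <= \sum_(0 <= k <oo) v k)%E.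
Proof.
move=> v0; apply: le_trans (nneseries_lim_ge n.+1 _); last by move=> *; exact: v0.
by rewrite big_nat_recr//= leeDr// sume_ge0.
Qed.

(** Let S be the series on the right.  Each increment is at most
x^(k/P) S^(1/P), so that the distance from [u 0] to the limit is at most a
geometric series times S^(1/P).  The weight thus turns the P-th power of a sum
into a sum of P-th powers. *)
Lemma telescope_powR_le u l P x : 0 < P -> 0 < x -> x < 1 ->
  (u @ \oo --> l) ->
  ((`|l - u 0%N| `^ P)%:E <= ((1 - x `^ P^-1)^-1 `^ P)%:E *
    \sum_(0 <= k <oo) (`|u k.+1 - u k| `^ P * x^-1 ^+ k)%:E)%E.
Proof.
move=> P0 x0 x1 ul.
set v := fun k => (`|u k.+1 - u k| `^ P * x^-1 ^+ k)%:E.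
have v0 k : (0 <= v k)%E.
  by rewrite lee_fin mulr_ge0 ?powR_ge0// exprn_ge0// invr_ge0 ltW.
set d := x `^ P^-1.
have d0 : 0 < d by rewrite powR_gt0.
have d1 : d < 1.
  have <- : 1 `^ P^-1 = 1 by rewrite powR1.
  apply: gt0_ltr_powR; rewrite ?invr_gt0 ?nnegrE//.
  exact: ltW.
have id0 : 0 < (1 - d)^-1 by rewrite invr_gt0 subr_gt0.
have dP : d `^ P = x by rewrite -powRrM mulVf ?gt_eqF// powRr1// ltW.
have := nneseries_ge0 (P := xpredT) (N := 0%N) (fun k _ _ => v0 k).
have := nneseries_term_le _ v0.
case: (\sum_(0 <= k <oo) v k)%E => [S| |] Sv S0 //; last first.
  by rewrite gt0_muley ?leey// lte_fin powR_gt0.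
rewrite -EFinM lee_fin; rewrite lee_fin in S0.
pose r := S `^ P^-1.
have r0 : 0 <= r by exact: powR_ge0.
have rP : r `^ P = S by rewrite -powRrM mulVf ?gt_eqF// powRr1.
have du k : `|u k.+1 - u k| <= r * d ^+ k.
  have := Sv k; rewrite lee_fin exprVn ler_pdivrMr ?exprn_gt0// => H.
  have : (`|u k.+1 - u k| `^ P) `^ P^-1 <= (S * x ^+ k) `^ P^-1.
    apply: ge0_ler_powR => //; rewrite ?nnegrE ?powR_ge0 ?invr_ge0 ?(ltW P0)//.
    by rewrite mulr_ge0// exprn_ge0// ltW.
  rewrite -powRrM mulfV ?gt_eqF// powRr1// powRM ?exprn_ge0 ?(ltW x0)//.
  by rewrite -(powR_mulrn _ (ltW x0)) powRAC powR_mulrn ?powR_ge0.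
have bnd n : `|u n - u 0%N| <= r * (1 - d)^-1.
  rewrite -(telescope_sumr u (leq0n n)) (le_trans (ler_norm_sum _ _ _))//.
  apply: (@le_trans _ _ (\sum_(0 <= k < n) r * d ^+ k)).
    by apply: ler_sum => k _; exact: du.
  by apply: geometric_le_lim => //; rewrite gtr0_norm.
have lim_bnd : `|l - u 0%N| <= r * (1 - d)^-1.
  have cn : (fun n => `|u n - u 0%N|) @ \oo --> `|l - u 0%N|.
    by apply: cvg_norm; apply: cvgB => //; exact: cvg_cst.
  rewrite -(cvg_lim _ cn)//; apply: limr_le; first exact: cvgP cn.
  exact: nearW.
rewrite -rP -powRM ?(ltW id0)// mulrC.
by apply: ge0_ler_powR; rewrite ?nnegrE ?(ltW P0) ?mulr_ge0 ?(ltW id0).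
Qed.
End series.

(** * Balls, separability and joint measurability of the distance *)

Section balls.
Context {R : realType} {X : pointedMetricType R}.
Variable mu : {outer_measure set X -> \bar R}.
Hypothesis mms : metric_measure_space mu.
Local Notation T := (caratheodory_type mu).
Implicit Types (x y z : X) (s t : R).

Lemma ball_mdist x s y : ball x s y <-> mdist x y < s.
Proof. by rewrite ballEmdist. Qed.

Lemma open_mball x s : open (ball x s).
Proof.
rewrite openE => y /ball_mdist xy; apply/nbhs_ballP.
exists (s - mdist x y) => /=; first by rewrite subr_gt0.
move=> z /ball_mdist yz; apply/ball_mdist.
by rewrite (le_lt_trans (metric_triangle x y z))// -ltrBrDl.
Qed.

Lemma sub_ball x y s t : mdist x y + s <= t -> ball y s `<=` ball x t.
Proof.
move=> st z /ball_mdist yz; apply/ball_mdist.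
rewrite (le_lt_trans (metric_triangle x y z))// (lt_le_trans _ st)//.
by rewrite ltrD2l.
Qed.

Lemma ediam_ball_le x s : (ediam (ball x s) <= (2 * s)%:E)%E.
Proof.
apply: ub_ereal_sup => _ [[y z] [/= /ball_mdist xy /ball_mdist xz] <-].
rewrite lee_fin (le_trans (metric_triangle y x z))// metric_sym mulr2n mulrDl.
by rewrite mul1r lerD// ltW.
Qed.

Lemma measurable_open_set (A : set X) : open A -> measurable (A : set T).
Proof. by move=> oA; case: mms => _ [+ _] _ _; apply; exact: sub_sigma_algebra. Qed.

Lemma measurable_mball x s : measurable (ball x s : set T).
Proof. exact/measurable_open_set/open_mball. Qed.

Lemma mu_ball_lty x s : (mu (ball x s) < +oo)%E.
Proof.
case: mms => _ _ + _; apply.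
exact: le_lt_trans (ediam_ball_le x s) (ltry _).
Qed.

Lemma mu_ball_gt0 x s : 0 < s -> (0 < mu (ball x s))%E.
Proof.
move=> s0; case: mms => _ _ _; apply; first exact: open_mball.
by exists x; exact: ballxx.
Qed.

Lemma mu_ball_fin x s : mu (ball x s) \is a fin_num.
Proof. by rewrite ge0_fin_numE ?outer_measure_ge0// mu_ball_lty. Qed.

Lemma bigcup_ball x : \bigcup_n ball x n.+1%:R = [set: X].
Proof.
apply/seteqP; split=> // y _; exists (Num.truncn (mdist x y)) => //.
by apply/ball_mdist; rewrite truncnS_gt.
Qed.

Lemma sigma_finite_cara : sigma_finite [set: T] (cara mu).
Proof.
exists (fun n => ball point n.+1%:R); first by rewrite bigcup_ball.
by move=> n; split; [exact: measurable_mball|exact: mu_ball_lty].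
Qed.

(** A disjoint family of balls of fixed radius is countable: otherwise
infinitely many of them, of measure bounded below, lie in one bounded set. *)
Lemma countable_disjoint_balls (D : set X) s : 0 < s ->
  trivIset D (fun x => ball x s) -> countable D.
Proof.
move=> s0 tD.
pose E n := D `&` [set x | ball x s `<=` ball point n.+1%:R /\
  ((n.+1%:R^-1)%:E <= mu (ball x s))%E].
have -> : D = \bigcup_n E n.
  apply/seteqP; split=> [x Dx|x [n _ []]//].
  have m0 : 0 < fine (mu (ball x s)) by rewrite fine_gt0// mu_ball_gt0// mu_ball_lty.
  set n := maxn (Num.truncn (mdist point x + s)) (Num.truncn (fine (mu (ball x s)))^-1).
  exists n => //; split=> //; split.
    apply: sub_ball; rewrite ltW// (lt_le_trans (truncnS_gt _))//.
    by rewrite ler_nat ltnS leq_maxl.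
  rewrite -(fineK (mu_ball_fin x s)) lee_fin invf_ple ?posrE//.
  by rewrite ltW// (lt_le_trans (truncnS_gt _))// ler_nat ltnS leq_maxr.
apply: bigcup_countable => // n _; apply: finite_set_countable.
apply: contrapT => /infiniteP/pcard_leP/injfunPex[/= u u_fun u_inj].
have uE k : E n (u k) by exact: u_fun.
have tu : trivIset setT (fun k => ball (u k) s).
  move=> i j _ _ ij; apply: u_inj; rewrite ?in_setE//.
  by apply: tD => //; [case: (uE i)|case: (uE j)].
have mU : measurable (\bigcup_k ball (u k) s : set T).
  by apply: bigcup_measurable => k _; exact: measurable_mball.
have : (mu (\bigcup_k ball (u k) s) <= mu (ball point n.+1%:R))%E.
  by apply: le_outer_measure => y [k _]; case: (uE k) => _ [+ _]; exact.
apply/negP; rewrite -ltNge (lt_le_trans (mu_ball_lty _ _))//.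
have -> : mu (\bigcup_k ball (u k) s) = (\sum_(0 <= k <oo) mu (ball (u k) s))%E.
  have -> := @measure_bigcup _ _ _ (cara mu) setT (fun k => ball (u k) s).
  - by apply: eq_eseriesl => i; rewrite in_setT.
  - by move=> k _; exact: measurable_mball.
  - exact: tu.
rewrite leye_eq; apply/eqP/eqyP => r r0.
set N := Num.truncn (r * n.+1%:R).
apply: (le_trans _ (nneseries_lim_ge N.+1 _)); last first.
  by move=> *; exact: outer_measure_ge0.
apply: (@le_trans _ _ (\sum_(0 <= k < N.+1) (n.+1%:R^-1)%:E)%E); last first.
  by apply: lee_sum => k _; case: (uE k) => _ [].
rewrite sumEFin lee_fin sumr_const_nat subn0 -[leRHS]mulr_natl.
by rewrite ler_pdivlMr// ltW// truncnS_gt.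
Qed.

(** By maximality, a ball of radius 1/n meets some member of a maximal disjoint
family of balls of radius 1/n, so the centres of these families, n = 1, 2, ...,
are dense. *)
Lemma separable_cara : exists2 D : set X, countable D &
  forall x e, 0 < e -> exists2 d, D d & mdist x d < e.
Proof.
pose r (n : nat) : R := n.+1%:R^-1.
have r0 n : 0 < r n by rewrite invr_gt0.
have E n := @ex_maximal_disjoint_subcollection _ _ (fun x : X => ball x (r n)) setT.
exists (\bigcup_n sval (E n)).
  apply: bigcup_countable => // n _.
  by case: (E n) => D [_ tD _] /=; exact: countable_disjoint_balls tD.
move=> x e e0.
have [n ne] : exists n, r n * 2 < e.
  exists (Num.truncn (2 / e)); rewrite /r.
  rewrite mulrC ltr_pdivrMr// mulrC -ltr_pdivrMr// truncnS_gt//.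
have [D [_ tD maxD] DE] : exists2 D, maximal_disjoint_subcollection
    (fun x : X => ball x (r n)) D setT & D = sval (E n).
  by exists (sval (E n)) => //; case: (E n).
suff [d Dd dx] : exists2 d, D d & ball x (r n) `&` ball d (r n) !=set0.
  exists d; first by exists n => //; rewrite -DE.
  case: dx => z [/ball_mdist xz /ball_mdist dz].
  rewrite (le_lt_trans (metric_triangle x z d))// (le_lt_trans _ ne)//.
  by rewrite (metric_sym z) mulr_natr mulr2n ltW// ltrD.
have [Dx|nDx] := pselect (D x).
  by exists x => //; exists x; split; exact: ballxx.
apply: contrapT => /forall2NP H.
apply: (maxD (x |` D)) => //.
  by split; [move=> y ?; right|move=> /(_ x)/=; move=> h; apply: nDx; apply: h; left].
move=> i j [->|Di] [->|Dj] ij //.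
- by case: (H j) => // /(_ ij).
- by case: (H i) => // h; exfalso; apply: h; rewrite setIC.
- exact: tD ij.
Qed.

(** If d(x, y) < s then some d of a countable dense set is so close to x that,
for a rational t, x lies in B(d, t) and y in B(d, s - t).  The set of such pairs
is therefore a countable union of products of balls. *)
Lemma measurable_dist_lt s :
  measurable ([set xy | mdist xy.1 xy.2 < s] : set (T * T)).
Proof.
have [D cD dD] := separable_cara.
rewrite (_ : [set _ | _] = \bigcup_(d in D) \bigcup_(t : rat)
    (ball d (ratr t) `*` ball d (s - ratr t))); last first.
  apply/seteqP; split=> [[x y] /= xy|[x y] [d Dd] [t _] []/=].
    have e0 : 0 < (s - mdist x y) / 3 by rewrite divr_gt0// subr_gt0.
    have [d Dd xd] := dD x _ e0; exists d => //.
    have [t] := rat_in_itvoo xd; rewrite in_itv/= => /andP[t1 t2].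
    exists t => //; split; apply/ball_mdist; rewrite /=; first by rewrite metric_sym.
    rewrite (le_lt_trans (metric_triangle d x y))// metric_sym.
    by move: xd t1 t2; lra.
  move=> /ball_mdist dx /ball_mdist dy.
  rewrite (le_lt_trans (metric_triangle x d y))// metric_sym.
  by move: dx dy; lra.
rewrite (bigcup_set_type D).
apply: countable_bigcupT_measurable; last first.
  move=> d; apply: bigcupT_measurable_rat => t.
  by apply: measurableX; exact: measurable_mball.
have /countable_injP[g g_inj] := cD.
apply/countable_injP; exists (g \o \val) => i j _ _ /= gij.
by apply/val_inj/g_inj => //; exact: valP.
Qed.
End balls.

(** * Tonelli's theorem over balls *)

Section sigma_finite_copy.
Context d (T : measurableType d) (R : realType) (m : {measure set T -> \bar R}).
Hypothesis sm : sigma_finite [set: T] m.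

Let copy : set T -> \bar R := m.
HB.instance Definition _ := Measure.on copy.
HB.instance Definition _ := Measure_isSigmaFinite.Build _ _ _ copy sm.

(** Tonelli's theorem reads sigma-finiteness from a structure on the measure;
this attaches the structure when sigma-finiteness is only a hypothesis. *)
Definition sigma_finite_copy : {sigma_finite_measure set T -> \bar R} := copy.
End sigma_finite_copy.

Section tonelli.
Context {R : realType} {X : pointedMetricType R}.
Variable mu : {outer_measure set X -> \bar R}.
Hypothesis mms : metric_measure_space mu.
Local Notation T := (caratheodory_type mu).
Local Notation m := (cara mu).
Local Open Scope ereal_scope.
Implicit Types (s t : R).

Lemma tonelli_cara (h : T * T -> \bar R) :
  measurable_fun setT h -> (forall z, 0 <= h z) ->
  [/\ measurable_fun setT (fun x => \int[m]_y h (x, y)),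
      measurable_fun setT (fun y => \int[m]_x h (x, y)) &
      \int[m]_x \int[m]_y h (x, y) = \int[m]_y \int[m]_x h (x, y)].
Proof.
move=> mh h0.
pose m' := sigma_finite_copy (sigma_finite_cara mms).
split.
- exact: (measurable_fun_fubini_tonelli_F (m2 := m') h mh h0).
- exact: (measurable_fun_fubini_tonelli_G (m1 := m') h mh h0).
- exact: (fubini_tonelli (m1 := m') (m2 := m') h mh h0).
Qed.

(** The condition d(x, y) < s is symmetric, so exchanging the integrals moves the
ball from the variable y to the variable x. *)
Lemma tonelli_ball (A : set T) s (h : T * T -> \bar R) : measurable A ->
  measurable_fun setT h -> (forall z, 0 <= h z) ->
  [/\ measurable_fun A (fun x => \int[m]_(y in ball x s) h (x, y)),
      measurable_fun setT (fun y : T => \int[m]_(x in A `&` ball y s) h (x, y)) &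
      \int[m]_(x in A) \int[m]_(y in ball x s) h (x, y) =
      \int[m]_y \int[m]_(x in A `&` ball y s) h (x, y)].
Proof.
move=> mA mh h0.
pose E : set (T * T) := (A `*` setT) `&` [set xy | (mdist xy.1 xy.2 < s)%R].
have mE : measurable E.
  by apply: measurableI; [exact: measurableX|exact: measurable_dist_lt].
have H1 x : (fun x => \int[m]_(y in ball x s) h (x, y)) \_ A x =
    \int[m]_y (h \_ E) (x, y).
  rewrite patchE; case: ifPn => xA.
    rewrite integral_mkcond; apply: eq_integral => y _; rewrite !patchE.
    congr (if _ then _ else _); apply/idP/idP; rewrite !inE /E/= => H.
      by split; [split=> //; exact/set_mem|exact/ball_mdist].
    by apply/ball_mdist; case: H.
  rewrite integral0_eq// => y _; rewrite patchE ifF//.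
  by apply/negbTE; rewrite notin_setE => -[[/= /mem_set]]; rewrite (negbTE xA).
have H2 y : \int[m]_(x in A `&` ball y s) h (x, y) = \int[m]_x (h \_ E) (x, y).
  rewrite integral_mkcond; apply: eq_integral => x _; rewrite !patchE.
  congr (if _ then _ else _); apply/idP/idP; rewrite !inE /E/= => -[].
    by move=> ? /ball_mdist; rewrite metric_sym.
  by move=> [? _]; rewrite metric_sym => /ball_mdist.
have [mF mG swap] : [/\ measurable_fun setT (fun x => \int[m]_y (h \_ E) (x, y)),
    measurable_fun setT (fun y => \int[m]_x (h \_ E) (x, y)) &
    \int[m]_x \int[m]_y (h \_ E) (x, y) =
    \int[m]_y \int[m]_x (h \_ E) (x, y)].
  apply: tonelli_cara; last by move=> z; apply: erestrict_ge0.
  by apply: (proj1 (measurable_restrictT _ mE)); exact: measurable_funTS.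
split.
- apply/(measurable_restrictT _ mA).2.
  by apply: eq_measurable_fun mF => x _; rewrite H1.
- by apply: eq_measurable_fun mG => y _; rewrite H2.
- rewrite integral_mkcond; under eq_integral do rewrite H1.
  by rewrite swap; apply: eq_integral => y _; rewrite H2.
Qed.

Lemma measurable_integral_ball s (g : T -> \bar R) :
  measurable_fun setT g -> (forall x, 0 <= g x) ->
  measurable_fun (setT : set T) (fun x => \int[m]_(y in ball x s) g y).
Proof.
move=> mg g0.
by have [] := @tonelli_ball setT s (g \o snd) measurableT
  (measurableT_comp mg (@measurable_snd _ _ _ _)) (fun z => g0 z.2).
Qed.

(** After the exchange, each [g y] is counted with the measure of the points of
the outer ball that are within s of y; these exist only if y is in the ball of
radius t + s. *)
Lemma integral_integral_ball_le x0 t s (g : T -> \bar R) (c : \bar R) :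
  measurable_fun setT g -> (forall x, 0 <= g x) -> 0 <= c ->
  (forall y, mu (ball x0 t `&` ball y s) <= c) ->
  \int[m]_(x in ball x0 t) \int[m]_(y in ball x s) g y <=
  c * \int[m]_(y in ball x0 (t + s)) g y.
Proof.
move=> mg g0 c0 hc.
have [_ _ ->] := @tonelli_ball (ball x0 t) s (g \o snd) (measurable_mball mms _ _)
  (measurableT_comp mg (@measurable_snd _ _ _ _)) (fun z => g0 z.2).
have mb := @measurable_mball _ _ _ mms.
have mI : measurable_fun (setT : set T)
    (fun y : T => mu (ball x0 t `&` ball y s)).
  rewrite (_ : (fun _ => _) =
      fun y : T => \int[m]_(x in ball y s) (\1_(ball x0 t) x)%:E).
    apply: measurable_integral_ball => [|x]; last by rewrite lee_fin.
    by apply/measurable_EFinP/measurable_indic/mb.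
  by apply/funext => y; rewrite integral_indic//; exact: mb.
have Eg y : \int[m]_(x in ball x0 t `&` ball y s) (g \o snd) (x, y) =
    g y * mu (ball x0 t `&` ball y s).
  by rewrite -integral_cst//; exact: measurableI.
under eq_integral do rewrite Eg.
rewrite -ge0_integralZl//; last exact: measurable_funTS.
rewrite [leRHS]integral_mkcond; apply: ge0_le_integral => //.
- by move=> y _; rewrite mule_ge0.
- exact: emeasurable_funM.
- apply: (proj1 (measurable_restrictT _ (mb _ _))).
  by apply: emeasurable_funM; [exact: measurable_cst|exact: measurable_funTS].
- move=> y _; rewrite patchE; case: ifPn => [_|yb]; first by rewrite muleC lee_wpmul2r.
  rewrite (_ : _ `&` _ = set0) ?outer_measure0 ?mule0//.
  apply/seteqP; split=> // x [/ball_mdist xx0 /ball_mdist yx].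
  move/negP : yb; apply; rewrite inE; apply/ball_mdist.
  rewrite (le_lt_trans (metric_triangle x0 x y))//.
  by rewrite ltrD// metric_sym.
Qed.
End tonelli.

(** * Means, truncation and admissible radii *)

Section jensen.
Local Open Scope ereal_scope.
Context d (T : measurableType d) (R : realType).
Variable m : {measure set T -> \bar R}.

(** The first term is enough where u <= l and the second one where u > l. *)
Lemma poweR_le_split (u : \bar R) (l r p : R) : 0 <= u -> (0 < l)%R ->
  (0 < r)%R -> (r < p)%R ->
  u `^ r <= (l `^ r)%:E + (l `^ (r - p))%:E * u `^ p.
Proof.
move=> u0 l0 r0 rp; have p0 : (0 < p)%R by exact: lt_trans rp.
have lp : (0 < l `^ (r - p))%R by rewrite powR_gt0.
have r_n0 : r != 0%R by rewrite gt_eqF.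
have p_n0 : p != 0%R by rewrite gt_eqF.
case: u u0 => [u| |]//; last first.
  by move=> _; rewrite !poweRyr// gt0_muley// addey.
rewrite lee_fin => u0; rewrite !poweR_EFin -EFinM -EFinD lee_fin.
have [ul|lu] := leP u l.
  rewrite ler_wpDr ?mulr_ge0 ?powR_ge0//.
  by rewrite ge0_ler_powR ?nnegrE// ltW.
have u_gt0 : (0 < u)%R by exact: lt_trans lu.
rewrite ler_wpDl ?powR_ge0//.
rewrite [in leLHS](_ : r = (r - p) + p)%R; last by ring.
rewrite powRD; last by rewrite (gt_eqF u_gt0) implybT.
rewrite ler_wpM2r ?powR_ge0//.
rewrite -(opprB p r) !powRN lef_pV2 ?posrE ?powR_gt0//.
by rewrite ge0_ler_powR ?nnegrE ?subr_ge0 ?ltW.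
Qed.

(** Jensen's inequality up to a factor 2: integrate [poweR_le_split] at the level
at which its two terms balance. *)
Lemma integral_poweR_le (D : set T) (g : T -> \bar R) (r p a : R) :
  measurable D -> m D < +oo -> measurable_fun D g -> (forall x, D x -> 0 <= g x) ->
  (0 < r)%R -> (r < p)%R -> (0 <= a)%R ->
  \int[m]_(x in D) g x `^ p <= a%:E * m D ->
  \int[m]_(x in D) g x `^ r <= (2 * a `^ (r / p))%:E * m D.
Proof.
move=> mD Doo mg g0 r0 rp a0 gp; have p0 : (0 < p)%R by exact: lt_trans rp.
have mgp q : measurable_fun D (fun x => g x `^ q).
  exact: (measurableT_comp (measurable_poweR _)).
have mDf : m D \is a fin_num by rewrite ge0_fin_numE.
have split_le (l : R) : (0 < l)%R ->
    \int[m]_(x in D) g x `^ r <= (l `^ r + l `^ (r - p) * a)%:E * m D.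
  move=> l0.
  apply: (@le_trans _ _ (\int[m]_(x in D)
      (cst (l `^ r)%:E x + (l `^ (r - p))%:E * g x `^ p))).
    apply: ge0_le_integral => //.
    - by move=> x Dx; exact: poweR_ge0.
    - by apply: emeasurable_funD => //; exact: measurable_funeM.
    - by move=> x Dx; apply: poweR_le_split => //; exact: g0.
  rewrite ge0_integralD//; last 3 first.
    - by move=> x _; rewrite lee_fin powR_ge0.
    - by move=> x _; rewrite mule_ge0 ?lee_fin ?powR_ge0 ?poweR_ge0.
    - exact: measurable_funeM.
  rewrite integral_cst// ge0_integralZl_EFin ?powR_ge0//; last first.
    by move=> x _; exact: poweR_ge0.
  rewrite EFinD ge0_muleDl ?lee_fin ?mulr_ge0 ?powR_ge0//.
  rewrite leeD2l// EFinM -muleA lee_wpmul2l// lee_fin powR_ge0//.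
(* The level is a^(1/p); if a = 0 it is any small number instead. *)
have [a_gt0|] := ltP 0%R a.
  have := split_le (a `^ p^-1)%R; rewrite powR_gt0// => /(_ isT).
  rewrite -!powRrM (_ : _ * a = a `^ (r / p))%R.
    by rewrite (mulrC p^-1%R) mulr_natl mulr2n.
  rewrite -[X in (_ * X)%R = _](powRr1 a0) -powRD; last first.
    by rewrite (gt_eqF a_gt0) implybT.
  by congr (_ `^ _)%R; field; rewrite gt_eqF.
move=> a_le0; have -> : a = 0%R by apply/eqP; rewrite eq_le a_le0.
rewrite powR0 ?mulr0; last by rewrite mulf_neq0 ?invr_neq0 ?gt_eqF.
rewrite mul0e; apply/lee_addgt0Pr => e e0; rewrite add0e.
have M0 : (0 < fine (m D) + 1)%R by rewrite ltr_wpDl// fine_ge0.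
have := split_le ((e / (fine (m D) + 1)) `^ r^-1)%R.
rewrite powR_gt0 ?divr_gt0// => /(_ isT).
rewrite (_ : a = 0%R); last by apply/eqP; rewrite eq_le a_le0.
rewrite mulr0 addr0 -powRrM mulVf ?gt_eqF// powRr1 ?divr_ge0 ?(ltW e0) ?(ltW M0)//.
move=> /le_trans; apply; rewrite -(fineK mDf) -EFinM lee_fin.
rewrite mulrAC ler_pdivrMr// ler_wpM2l ?(ltW e0)//=.
by rewrite lerDl.
Qed.
End jensen.

Section means.
Context {R : realType} {X : pointedMetricType R}.
Variable mu : {outer_measure set X -> \bar R}.
Hypothesis mms : metric_measure_space mu.
Local Notation T := (caratheodory_type mu).
Local Notation m := (cara mu).
Local Open Scope ereal_scope.

Lemma borel_measurable_cara (D : set X) (g : X -> \bar R) :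
  measurable (D : set T) -> borel_measurable_fun setT g ->
  measurable_fun (D : set T) (g : T -> \bar R).
Proof.
move=> mD mg; apply: (@measurable_funTS _ _ T _ D g) => _ Y mY.
by case: mms => _ [+ _] _ _; apply; exact: mg.
Qed.

Lemma mean_sub_le (B D : set T) (f : T -> R) (a : R) :
  measurable B -> measurable D -> B `<=` D -> m D < +oo -> 0 < m B ->
  m.-integrable D (EFin \o f) ->
  `|mean mu B f - a|%:E <=
  (fine (mu B))^-1%:E * \int[m]_(y in D) `|f y - a|%:E.
Proof.
move=> mB mD BD Doo B0 If.
have Boo : m B < +oo by apply: le_lt_trans Doo; apply: le_measure; rewrite ?inE.
have mBf : m B \is a fin_num by rewrite ge0_fin_numE.
have fB0 : (0 < fine (m B))%R by rewrite fine_gt0// B0.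
have IfB : m.-integrable B (EFin \o f) by exact: integrableS If.
have Ia D' : measurable D' -> m D' < +oo -> m.-integrable D' (EFin \o cst a).
  move=> mD' D'oo; apply/integrableP; split.
    by apply/measurable_EFinP; exact: measurable_cst.
  rewrite /= (integral_cst _ mD' `|a|%:E) lte_mul_pinfty ?lee_fin//.
have -> : (mean mu B f - a = (fine (m B))^-1 * \int[m]_(y in B) (f y - a))%R.
  rewrite RintegralB// ?Rintegral_cst//; last exact: Ia.
  by rewrite /mean mulrBr; congr (_ - _)%R; rewrite mulrCA mulVf ?mulr1// gt_eqF.
have mfa : measurable_fun D (fun y => `|f y - a|%:E).
  apply/measurable_EFinP; apply: measurableT_comp => //.
  by apply: measurable_funB => //; apply/measurable_EFinP; exact: measurable_int If.
rewrite normrM ger0_norm ?invr_ge0 ?(ltW fB0)// EFinM lee_wpmul2l//.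
apply: (@le_trans _ _ (\int[m]_(y in B) `|f y - a|%:E)); last first.
  exact: ge0_subset_integral.
have IB : m.-integrable B (EFin \o (fun y => f y - a)%R).
  exact: (integrableB mB IfB (Ia _ mB Boo)).
rewrite EFin_normr_Rintegral//.
by apply: le_abse_integral => //; exact: measurable_int IB.
Qed.
End means.

Section radii.
Context {R : realType} {X : pointedMetricType R}.
Implicit Types s t : R.

(** The radii to which Ahlfors regularity applies. *)
Definition regular_radius s : Prop := (s%:E < 2%:E * ediam [set: X])%E.

Lemma mdist_le_ediam (x y : X) : ((mdist x y)%:E <= ediam [set: X])%E.
Proof. by rewrite /ediam; apply: ereal_sup_ubound; exists (x, y). Qed.

Lemma ediam_ge0 : (0 <= ediam [set: X])%E.
Proof. by have := mdist_le_ediam point point; rewrite mdistxx. Qed.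

Lemma regular_radius_le s t : s <= t -> regular_radius t -> regular_radius s.
Proof. by move=> st; apply: le_lt_trans; rewrite lee_fin. Qed.

(** In a bounded space every ball of large radius is the whole space, hence a
ball of a radius to which Ahlfors regularity applies. *)
Lemma ball_regular_radius t : (0 < ediam [set: X])%E -> 0 < t ->
  exists s, [/\ 0 < s, s <= t, regular_radius s &
    forall x : X, ball x s = ball x t].
Proof.
move=> D0 t0; have [?|] := pselect (regular_radius t); first by exists t.
rewrite /regular_radius => /negP; rewrite -leNgt.
case dE : (ediam [set: X]) D0 => [d| |]//; last first.
  by move=> _; rewrite gt0_muley// leye_eq.
rewrite lte_fin => d0; rewrite -EFinM lee_fin => dt.
have d_ub (x y : X) : mdist x y <= d.
  by rewrite -lee_fin -dE mdist_le_ediam.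
exists (3 / 2 * d); split.
- by rewrite mulr_gt0// divr_gt0.
- by move: dt d0; lra.
- by rewrite lte_fin; move: d0; lra.
- move=> x; apply/seteqP; split=> y _; apply/ball_mdist.
    by rewrite (le_lt_trans (d_ub x y))// (lt_le_trans _ dt)//; move: d0; lra.
  by rewrite (le_lt_trans (d_ub x y))//; move: d0; lra.
Qed.

Lemma ediam_eq0 : ediam [set: X] = 0%E -> forall x y : X, x = y.
Proof.
move=> D0 x y; apply: mdist_positivity; apply/eqP; rewrite eq_le mdist_ge0 andbT.
by rewrite -lee_fin (le_trans (mdist_le_ediam x y))// D0.
Qed.
End radii.

(** * Consequences of Ahlfors regularity and of the Poincare inequality *)

Section regularity.
Context {R : realType} {X : pointedMetricType R}.
Variable mu : {outer_measure set X -> \bar R}.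
Hypothesis mms : metric_measure_space mu.
Local Notation T := (caratheodory_type mu).
Local Notation m := (cara mu).

(** Unlike the lower bound, the upper bound extends to all radii: a large ball is
also a ball of a smaller, regular radius. *)
Definition ahlfors_bounds (Q C : R) : Prop :=
  [/\ 1 <= C,
    forall (x : X) t, 0 < t -> (mu (ball x t) <= (C * t `^ Q)%:E)%E &
    forall (x : X) t, 0 < t -> regular_radius (X := X) t ->
      ((C^-1 * t `^ Q)%:E <= mu (ball x t))%E].

Lemma ahlfors_regular_bounds Q : (0 < ediam [set: X])%E -> 0 < Q ->
  ahlfors_regular mu Q -> exists C, ahlfors_bounds Q C.
Proof.
move=> D0 Q0 [C C1 HC]; exists C; split => // x t t0; last first.
  by move=> rt; have /andP[] := HC x t t0 rt.
have [s [s0 st rs <-]] := ball_regular_radius D0 t0.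
have /andP[_] := HC x s s0 rs; move=> /le_trans; apply.
rewrite lee_fin ler_wpM2l ?(le_trans _ C1)//.
by rewrite ge0_ler_powR ?nnegrE// ltW.
Qed.

(** The exponent [r] of the Poincare inequality is raised to [p] by Jensen's
inequality, and the measure of the enlarged ball is replaced by the power of the
radius that bounds it from below.  [W] stands for any bound on the energy, which
keeps the conclusion an inequality between real numbers. *)
Lemma weak_poincare_energy Q C r p : 0 < Q -> ahlfors_bounds Q C ->
  1 <= r -> r < p -> weak_poincare mu r ->
  exists K tau, [/\ 0 < K, 1 <= tau &
    forall (f : X -> R) rho (x : X) (s W : R), 0 < s -> regular_radius (X := X) s ->
      upper_gradient_in mu setT f rho ->
      m.-integrable (ball x s) (EFin \o f) -> 0 <= W ->
      (\int[m]_(y in ball x (tau * s)) rho y `^ p <= W%:E)%E ->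
      (\int[m]_(y in ball x s) `|f y - mean mu (ball x s) f|%:E <=
        (K * s * (s `^ (- Q) * W) `^ p^-1)%:E * mu (ball x s))%E].
Proof.
move=> Q0 [C1 up lo] r1 rp [K [tau [K0 tau1 PI]]].
have r0 : 0 < r by rewrite (lt_le_trans _ r1).
have p0 : 0 < p by exact: lt_trans rp.
have C0 : 0 < C by rewrite (lt_le_trans _ C1).
exists (K * 2 * 2 `^ r^-1 * C `^ p^-1), tau; split => //.
  by rewrite !mulr_gt0 ?powR_gt0.
move=> f rho x s W s0 rs ug If W0 HW.
have tau0 : 0 < tau by rewrite (lt_le_trans _ tau1).
have ts0 : 0 < tau * s by rewrite mulr_gt0.
have mB := @measurable_mball _ _ _ mms.
have mBf := @mu_ball_fin _ _ _ mms.
have fB (y : X) t : 0 < t -> 0 < fine (mu (ball y t)).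
  by move=> t0; rewrite fine_gt0// mu_ball_gt0// mu_ball_lty.
case: ug => mf mrho rho0 ug.
have mrhoT : measurable_fun (ball x (tau * s) : set T) (rho : T -> \bar R).
  by apply: borel_measurable_cara.
have ugB : upper_gradient_in mu (ball x (tau * s)) f rho.
  split.
  - exact: (@measurable_funTS _ _ T _ _ _ mf).
  - exact: (@measurable_funTS _ _ (borel_type X) _ _ _ mrho).
  - by move=> y _; exact: rho0.
  - by move=> g gc _; apply: ug.
have {PI} := PI x s f rho s0 ugB If; cbv zeta.
set a := C * (s `^ (- Q) * W).
have a0 : 0 <= a by rewrite !mulr_ge0 ?powR_ge0// ltW.
have Wa : (W%:E <= a%:E * mu (ball x (tau * s)))%E.
  rewrite -(fineK (mBf _ _)) -EFinM lee_fin.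
  have : C^-1 * s `^ Q <= fine (mu (ball x (tau * s))).
    rewrite -lee_fin fineK ?mBf// (le_trans (lo x s s0 rs))//.
    apply: le_outer_measure; apply: le_ball.
    by rewrite ler_peMl// ltW.
  move=> /(ler_wpM2l a0); apply: le_trans.
  rewrite /a powRN; set S := s `^ Q.
  have S0 : 0 < S by rewrite powR_gt0.
  suff -> : C * (S^-1 * W) * (C^-1 * S) = W by [].
  by field; rewrite !gt_eqF.
have := @integral_poweR_le _ _ _ m (ball x (tau * s)) rho r p a (mB _ _)
  (mu_ball_lty mms _ _) mrhoT (fun y _ => rho0 y I) r0 rp a0 (le_trans HW Wa).
move=> J PI.
have {}J : (emean mu (ball x (tau * s)) (fun y => rho y `^ r)%E
    <= (2 * a `^ (r / p))%:E)%E.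
  rewrite /emean muleC lee_pdivrMr ?fB// muleC.
  by rewrite fineK ?mBf// muleC.
have {}J : (emean mu (ball x (tau * s)) (fun y => rho y `^ r) `^ r^-1
    <= (2 `^ r^-1 * a `^ p^-1)%:E)%E.
  have H0 : (0 <= emean mu (ball x (tau * s)) (fun y => rho y `^ r))%E.
    rewrite /emean mule_ge0 ?lee_fin ?invr_ge0 ?fine_ge0 ?outer_measure_ge0//.
    by apply: integral_ge0 => y _; exact: poweR_ge0.
  have -> : 2 `^ r^-1 * a `^ p^-1 = (2 * a `^ (r / p)) `^ r^-1.
    rewrite powRM ?powR_ge0// -powRrM; congr (_ * _ `^ _).
    by field; rewrite !gt_eqF.
  rewrite -poweR_EFin; apply: gt0_ler_poweR => //.
  - by rewrite invr_ge0 ltW.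
  - by rewrite in_itv/= leey andbT.
  - by rewrite in_itv/= leey andbT lee_fin mulr_ge0// powR_ge0.
have {}PI : (emean mu (ball x s) (fun y => `|f y - mean mu (ball x s) f|%:E) <=
    (K * (2 * s) * (2 `^ r^-1 * a `^ p^-1))%:E)%E.
  apply: (le_trans PI); rewrite !EFinM.
  apply: lee_pmul => //.
  - rewrite mule_ge0// ?lee_fin ?(ltW K0)//.
    by rewrite /ediam; apply: ereal_sup_ubound; exists (x, x) => /=; rewrite ?mdistxx//; split; exact: ballxx.
  - exact: poweR_ge0.
  - rewrite lee_wpmul2l ?lee_fin ?(ltW K0)//.
    by rewrite -EFinM; exact: ediam_ball_le.
move: PI; rewrite /emean muleC lee_pdivrMr ?fB// fineK ?mBf//.
move=> /le_trans; apply; apply: lee_wpmul2r; first exact: outer_measure_ge0.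
rewrite lee_fin /a powRM ?mulr_ge0 ?powR_ge0 ?(ltW C0)//.
by rewrite le_eqVlt; apply/orP; left; apply/eqP; ring.
Qed.
End regularity.

(** * Comparison of a function with its averages *)

Section estimates.
Context {R : realType} {X : pointedMetricType R}.
Variable mu : {outer_measure set X -> \bar R}.
Hypothesis mms : metric_measure_space mu.
Local Notation T := (caratheodory_type mu).
Local Notation m := (cara mu).

Variables Q C p e K tau : R.
Hypothesis Q0 : 0 < Q.
Hypothesis AB : ahlfors_bounds mu Q C.
Hypothesis p1 : 1 <= p.
Hypotheses (e0 : 0 < e) (e1 : e <= 1).
Hypothesis K0 : 0 < K.
Hypothesis tau1 : 1 <= tau.

Variables (g : T -> \bar R) (A : R).
Hypothesis mg : measurable_fun setT g.
Hypothesis g0 : forall x, (0 <= g x)%E.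
Hypothesis A0 : 0 <= A.
Hypothesis gA : forall x t, 0 < t ->
  (\int[m]_(y in ball x t) g y <= (A * t `^ (Q * (1 - e)))%:E)%E.

Variable f : T -> R.
Hypothesis mf : measurable_fun setT f.
Hypothesis If : forall (x : X) t, m.-integrable (ball x t) (EFin \o f).

Definition ball_mean s (x : T) : R := mean mu (ball x s) f.
Local Notation F := ball_mean.

Definition energy s (x : T) : R := fine (\int[m]_(y in ball x (tau * s)) g y)%E.

(** The bound that the Poincare inequality gives for the mean oscillation of f
over the ball of centre x and radius s. *)
Definition osc_bound s (x : T) : R := K * s * (s `^ (- Q) * energy s x) `^ p^-1.

Hypothesis PI : forall (x : X) s, 0 < s -> regular_radius (X := X) s ->
  (\int[m]_(y in ball x s) `|f y - F s x|%:E <=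
    (osc_bound s x)%:E * mu (ball x s))%E.

Let C0 : 0 < C. Proof. by case: AB => C1 _ _; rewrite (lt_le_trans _ C1). Qed.
Let p0 : 0 < p. Proof. by rewrite (lt_le_trans _ p1). Qed.
Let tau0 : 0 < tau. Proof. by rewrite (lt_le_trans _ tau1). Qed.
Let mB (x : X) s : measurable (ball x s : set T).
Proof. exact: measurable_mball. Qed.

Lemma integral_ball_lty x t : 0 < t -> (\int[m]_(y in ball x t) g y < +oo)%E.
Proof. by move=> t0; rewrite (le_lt_trans (gA x t0))// ltry. Qed.

Lemma energyE s x : 0 < s -> (energy s x)%:E = (\int[m]_(y in ball x (tau * s)) g y)%E.
Proof.
move=> s0; rewrite fineK// ge0_fin_numE ?integral_ball_lty ?mulr_gt0//.
exact: integral_ge0.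
Qed.

Lemma energy_ge0 s x : 0 <= energy s x.
Proof. by apply: fine_ge0; exact: integral_ge0. Qed.

Lemma osc_bound_ge0 s x : 0 < s -> 0 <= osc_bound s x.
Proof. by move=> s0; rewrite !mulr_ge0 ?powR_ge0// ltW. Qed.

Lemma measurable_energy s : measurable_fun (setT : set T) (energy s).
Proof.
apply: (measurableT_comp (fine_measurable measurableT)).
exact: measurable_integral_ball.
Qed.

Lemma measurable_osc_bound s : measurable_fun (setT : set T) (osc_bound s).
Proof.
apply: measurable_funM => //.
apply: (measurableT_comp (measurable_powR _)).
by apply: measurable_funM => //; exact: measurable_energy.
Qed.

Lemma measurable_ball_mean s : measurable_fun (setT : set T) (F s).
Proof.
apply: measurable_funM.
  rewrite (_ : (fun _ => _) = fun x : T =>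
    (fine (\int[m]_(y in ball x s) (cst 1%E y))%E) `^ (-1)).
    apply: (measurableT_comp (measurable_powR _)).
    apply: (measurableT_comp (fine_measurable measurableT)).
    by apply: measurable_integral_ball.
  apply/funext => x; rewrite integral_cst; last exact: mB.
  by rewrite mul1e powR_inv1// fine_ge0.
apply: (measurableT_comp (fine_measurable measurableT)).
rewrite (_ : (fun _ => _) = fun x : T =>
  (\int[m]_(y in ball x s) (EFin \o f)^\+ y
   - \int[m]_(y in ball x s) (EFin \o f)^\- y)%E); last first.
  by apply/funext => x; rewrite integralE.
have mEf : measurable_fun setT (EFin \o f) by exact/measurable_EFinP.
apply: emeasurable_funB; apply: measurable_integral_ball => //.
  exact: measurable_funepos.
exact: measurable_funeneg.
Qed.

Lemma measurable_norm_sub (D : set T) (u v : T -> R) :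
  measurable_fun setT u -> measurable_fun setT v ->
  measurable_fun D (fun x => `|u x - v x|).
Proof.
move=> mu' mv; apply: measurable_funTS.
exact: (measurableT_comp (@normr_measurable R setT) (measurable_funB mu' mv)).
Qed.

Lemma measurable_norm_sub_powR (D : set T) (u v : T -> R) b :
  measurable_fun setT u -> measurable_fun setT v ->
  measurable_fun D (fun x => (`|u x - v x| `^ b)%:E).
Proof.
move=> mu' mv; apply/measurable_EFinP.
exact: (measurableT_comp (@measurable_powR R b) (measurable_norm_sub mu' mv)).
Qed.

Lemma energy_le s x : 0 < s -> energy s x <= A * (tau * s) `^ (Q * (1 - e)).
Proof.
by move=> s0; rewrite -lee_fin energyE// gA// mulr_gt0.
Qed.

(** Each point is counted with the measure of the intersection of two balls, of
radii t and u = tau s.  Writing w for the smaller and W for the larger radius, the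
result is at most a multiple of w^Q W^(Q(1-e)), and this is at most
t^(Q(1-e)) u^Q in either order of t and u. *)
Lemma integral_energy_le s x0 t : 0 < s -> 0 < t ->
  (\int[m]_(x in ball x0 t) (energy s x)%:E <=
   (C * A * 2 `^ (Q * (1 - e)) * tau `^ Q * t `^ (Q * (1 - e)) * s `^ Q)%:E)%E.
Proof.
move=> s0 t0; set u := tau * s; set a := Q * (1 - e).
have u0 : 0 < u by rewrite mulr_gt0.
have a0 : 0 <= a by rewrite mulr_ge0 ?subr_ge0// ltW.
have [_ up _] := AB.
under eq_integral do rewrite energyE//.
have -> : C * A * 2 `^ a * tau `^ Q * t `^ a * s `^ Q =
    C * (A * 2 `^ a) * (t `^ a * u `^ Q).
  by rewrite /u powRM ?(ltW s0) ?(ltW tau0)//; ring.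
have main c v : 0 < c -> 0 < v -> t + u <= 2 * v ->
    (forall y, mu (ball x0 t `&` ball y u) <= (C * c `^ Q)%:E)%E ->
    (\int[m]_(x in ball x0 t) \int[m]_(y in ball x u) g y <=
      (C * (A * 2 `^ a) * (v `^ a * c `^ Q))%:E)%E.
  move=> c0 v0 tuv hc.
  apply: (@le_trans _ _ ((C * c `^ Q)%:E *
      \int[m]_(y in ball x0 (t + u)) g y)%E).
    by apply: integral_integral_ball_le => //; rewrite lee_fin mulr_ge0 ?powR_ge0// ltW.
  rewrite (_ : C * _ * _ = C * c `^ Q * (A * (2 * v) `^ a)); last first.
    by rewrite powRM ?(ltW v0)//; ring.
  rewrite [leRHS]EFinM lee_wpmul2l ?lee_fin ?mulr_ge0 ?powR_ge0 ?(ltW C0)//.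
  rewrite (le_trans (gA _ _)) ?addr_gt0// lee_fin ler_wpM2l//.
  apply: ge0_ler_powR => //; rewrite nnegrE; first by rewrite ltW// addr_gt0.
  by rewrite ltW// mulr_gt0.
have [ut|tu] := leP u t.
  apply: main => //; first by move: ut; lra.
  by move=> y; apply: le_trans (up y u u0); apply: le_outer_measure; exact: subIsetr.
apply: (le_trans (main t u t0 u0 _ _)); first by move: tu; lra.
  by move=> y; apply: le_trans (up x0 t t0); apply: le_outer_measure; exact: subIsetl.
rewrite lee_fin ler_wpM2l ?mulr_ge0 ?powR_ge0 ?(ltW C0)//.
have aQ : Q = a + Q * e by rewrite /a; ring.
rewrite [in X in _ * t `^ X]aQ [in X in _ <= _ * u `^ X]aQ.
rewrite !powRD ?(gt_eqF t0) ?(gt_eqF u0) ?implybT//.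
rewrite mulrCA ler_wpM2l ?powR_ge0// ler_wpM2l ?powR_ge0//.
apply: ge0_ler_powR; rewrite ?nnegrE ?(ltW t0) ?(ltW u0) ?(ltW tu)//.
by rewrite ltW// mulr_gt0.
Qed.

(** The smaller ball is contained in the larger one and has comparable measure, so
its mean differs from that of the larger ball by at most a multiple of the
oscillation there. *)
Lemma ball_mean_near s x z : 0 < s -> regular_radius (X := X) (2 * s) ->
  mdist (z : X) x <= s ->
  `|F s x - F (2 * s) z| <= C ^+ 2 * 2 `^ Q * osc_bound (2 * s) z.
Proof.
move=> s0 rs zx; have s20 : 0 < 2 * s by rewrite mulr_gt0.
have [C1 up lo] := AB.
have sub : ball (x : X) s `<=` ball (z : X) (2 * s).
  by apply: sub_ball; move: zx; lra.
have rs1 : regular_radius (X := X) s.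
  by apply: regular_radius_le rs; move: s0; lra.
have Bx0 : 0 < fine (mu (ball (x : X) s)).
  by rewrite fine_gt0// mu_ball_gt0// mu_ball_lty.
rewrite -lee_fin; apply: le_trans
  (mean_sub_le (D := ball z (2 * s)) (F (2 * s) z) _ _ sub _ _ _) _ => //.
- exact: mu_ball_lty.
- exact: mu_ball_gt0.
rewrite muleC lee_pdivrMr//; apply: (le_trans (PI z s20 rs)).
rewrite -(fineK (mu_ball_fin mms z _)) -!EFinM lee_fin mulrC mulrAC.
rewrite ler_wpM2r ?osc_bound_ge0//.
apply: (@le_trans _ _ (C * (2 * s) `^ Q)).
  by rewrite -lee_fin fineK ?mu_ball_fin// up.
rewrite powRM ?(ltW s0)//.
have : C^-1 * s `^ Q <= fine (mu (ball (x : X) s)).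
  by rewrite -lee_fin fineK ?mu_ball_fin// lo.
have c0 : 0 <= C ^+ 2 * 2 `^ Q by rewrite mulr_ge0 ?powR_ge0// exprn_ge0 ?(ltW C0).
move=> /(ler_wpM2l c0); apply: le_trans.
rewrite le_eqVlt; apply/orP; left; apply/eqP; field.
by rewrite gt_eqF.
Qed.

(** For every z within s of x, |f x - F s x| is at most |f x - F (2 s) z| plus a
multiple of the oscillation at z.  Averaging this over z and exchanging the
integrals leaves, for each z, the mean oscillation over B(z, 2 s). *)
Lemma integral_osc_le : exists2 c, 0 <= c & forall x0 t s,
  0 < t -> 0 < s -> regular_radius (X := X) (2 * s) ->
  (\int[m]_(x in ball x0 t) `|f x - F s x|%:E <=
   c%:E * \int[m]_(z in ball x0 (t + s)) (osc_bound (2 * s) z)%:E)%E.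
Proof.
have [C1 up lo] := AB.
set c := C ^+ 2 * 2 `^ Q.
have c0 : 0 <= c by rewrite mulr_ge0 ?powR_ge0// exprn_ge0 ?(ltW C0).
exists (c * (1 + c)); first by rewrite mulr_ge0// addr_ge0.
move=> x0 t s t0 s0 rs.
have s20 : 0 < 2 * s by rewrite mulr_gt0.
have rs1 : regular_radius (X := X) s.
  by apply: regular_radius_le rs; move: s0; lra.
set b := C^-1 * s `^ Q.
have b0 : 0 < b by rewrite mulr_gt0 ?powR_gt0// invr_gt0.
have G0 z : 0 <= osc_bound (2 * s) z by exact: osc_bound_ge0.
have mF := measurable_ball_mean (2 * s).
have mG := measurable_osc_bound (2 * s).
have [h hE] : exists h : T * T -> \bar R, h =
    fun z => (`|f z.1 - F (2 * s) z.2| + c * osc_bound (2 * s) z.2)%:E.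
  by eexists.
have mh : measurable_fun setT h.
  rewrite hE; apply/measurable_EFinP.
  pose m1 := @measurable_fst _ _ T T; pose m2 := @measurable_snd _ _ T T.
  apply: measurable_funD (measurable_funM (measurable_cst c) (measurableT_comp mG m2)).
  apply: (measurableT_comp (@normr_measurable R setT)).
  exact: measurable_funB (measurableT_comp mf m1) (measurableT_comp mF m2).
have h0 z : (0 <= h z)%E by rewrite hE lee_fin addr_ge0// mulr_ge0.
have [mh1 mh2 swap] := tonelli_ball mms (A := ball x0 t) s (mB _ _) mh h0.
have mfF : measurable_fun (ball x0 t : set T) (fun x => `|f x - F s x|%:E).
  apply/measurable_EFinP.
  exact: (measurable_norm_sub mf (measurable_ball_mean s)).
have step1 : (b%:E * \int[m]_(x in ball x0 t) `|f x - F s x|%:E <=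
    \int[m]_(x in ball x0 t) \int[m]_(y in ball x s) h (x, y))%E.
  rewrite -ge0_integralZl_EFin ?(ltW b0)//.
  apply: ge0_le_integral => //.
  - by move=> x _; rewrite -EFinM lee_fin mulr_ge0 ?(ltW b0).
  - exact: measurable_funeM.
  move=> x _; apply: (@le_trans _ _ (`|f x - F s x|%:E * mu (ball x s))%E).
    by rewrite muleC lee_wpmul2l ?lee_fin//; exact: lo.
  rewrite -(integral_cst m (mB x s)); apply: ge0_le_integral => //.
  - by move=> z _; rewrite lee_fin.
  - apply: measurable_funTS; apply: (measurableT_comp mh).
    exact: (@measurable_pair1 _ _ _ _ x).
  move=> z /ball_mdist xz; rewrite hE lee_fin /=.
  have := @ball_mean_near s x z s0 rs; rewrite metric_sym => /(_ (ltW xz)).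
  rewrite distrC => H.
  rewrite (le_trans (ler_distD (F (2 * s) z) _ _))// lerD2l.
  exact: H.
have step2 : (\int[m]_y \int[m]_(x in ball x0 t `&` ball y s) h (x, y) <=
   ((1 + c) * (C * (2 * s) `^ Q))%:E *
     \int[m]_(z in ball x0 (t + s)) (osc_bound (2 * s) z)%:E)%E.
  have k0 : 0 <= (1 + c) * (C * (2 * s) `^ Q).
    by rewrite mulr_ge0 ?addr_ge0 ?mulr_ge0 ?powR_ge0 ?(ltW C0).
  rewrite -ge0_integralZl_EFin//; last 2 first.
  - by move=> z _; rewrite lee_fin.
  - by apply/measurable_EFinP; exact: measurable_funTS.
  rewrite [leRHS]integral_mkcond; apply: ge0_le_integral => //.
  - by move=> y _; exact: integral_ge0.
  - apply: (proj1 (measurable_restrictT _ (mB _ _))).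
    by apply: measurable_funeM; apply/measurable_EFinP; exact: measurable_funTS.
  move=> z _; rewrite patchE; case: ifPn => [_|zb]; last first.
    rewrite (_ : _ `&` _ = set0) ?integral_set0//.
    apply/seteqP; split=> // x [/ball_mdist xx0 /ball_mdist zx].
    move/negP : zb; apply; rewrite inE; apply/ball_mdist.
    by rewrite (le_lt_trans (metric_triangle x0 x z))// ltrD// metric_sym.
  have mhz : measurable_fun (ball z (2 * s) : set T) (fun x => h (x, z)).
    apply: measurable_funTS; apply: (measurableT_comp mh).
    exact: (@measurable_pair2 _ _ _ _ z).
  apply: (@le_trans _ _ (\int[m]_(x in ball z (2 * s)) h (x, z))%E).
    apply: ge0_subset_integral => //; first exact: measurableI.
    move=> x [_]; apply: sub_ball; rewrite mdistxx add0r; move: s0; lra.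
  rewrite (eq_integral (fun x => `|f x - F (2 * s) z|%:E +
      cst (c * osc_bound (2 * s) z)%:E x)%E); last by move=> x _; rewrite hE EFinD.
  rewrite ge0_integralD; last 5 first.
  - exact: mB.
  - by move=> x _; rewrite lee_fin.
  - apply/measurable_EFinP.
    exact: (measurable_norm_sub mf (measurable_cst (F (2 * s) z))).
  - by move=> x _; rewrite lee_fin mulr_ge0.
  - exact: measurable_cst.
  rewrite (integral_cst m (mB z (2 * s)) (c * osc_bound (2 * s) z)%:E).
  apply: (le_trans (leeD2r _ (PI z s20 rs))).
  have -> : m (ball z (2 * s)) = mu (ball (z : X) (2 * s)) by [].
  rewrite -(fineK (mu_ball_fin mms z _)) -!EFinM -EFinD lee_fin.
  rewrite -mulrDl -{1}(mul1r (osc_bound _ _)) -mulrDl mulrAC ler_wpM2r//.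
  rewrite ler_wpM2l ?addr_ge0//.
  by rewrite -lee_fin fineK ?mu_ball_fin// up.
rewrite swap in step1.
have := le_trans step1 step2; rewrite -lee_pdivlMl// muleA -EFinM.
have -> // : b^-1 * ((1 + c) * (C * (2 * s) `^ Q)) = c * (1 + c).
rewrite powRM ?(ltW s0)// /b /c.
have S0 : s `^ Q != 0 by rewrite gt_eqF// powR_gt0.
have C_n0 : C != 0 by rewrite gt_eqF.
by field; rewrite S0 C_n0.
Qed.

(** The factor s of the oscillation bound survives because the mean energy is
bounded uniformly in s; y^(1/p) <= 1 + y reduces to the energy itself. *)
Lemma integral_osc_bound_le x0 t : 0 < t -> exists2 M, 0 <= M &
  forall s, 0 < s ->
    (\int[m]_(x in ball x0 t) (osc_bound s x)%:E <= (M * s)%:E)%E.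
Proof.
move=> t0; have [_ up _] := AB.
set B := C * A * 2 `^ (Q * (1 - e)) * tau `^ Q * t `^ (Q * (1 - e)).
have B0 : 0 <= B by rewrite !mulr_ge0 ?powR_ge0 ?(ltW C0).
exists (K * (C * t `^ Q + B)).
  by rewrite mulr_ge0 ?(ltW K0)// addr_ge0// mulr_ge0 ?powR_ge0 ?(ltW C0).
move=> s s0; have sQ : 0 < s `^ (- Q) by rewrite powR_gt0.
have Ks : 0 < K * s by rewrite mulr_gt0.
have mE : measurable_fun (ball x0 t : set T) (fun x => (s `^ (- Q) * energy s x)%:E).
  apply/measurable_EFinP; apply: measurable_funTS.
  exact: measurable_funM (measurable_cst _) (measurable_energy s).
have m1 := @measurable_cst _ _ T (\bar R) (ball x0 t) 1%E.
have pE x : (0 <= (s `^ (- Q) * energy s x)%:E)%E.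
  by rewrite lee_fin mulr_ge0 ?energy_ge0// ltW.
apply: (@le_trans _ _ ((K * s)%:E * \int[m]_(x in ball x0 t)
   (cst 1 x + (s `^ (- Q) * energy s x)%:E))%E).
  rewrite -ge0_integralZl_EFin; last 4 first.
  - exact: mB.
  - by move=> x _; exact: adde_ge0.
  - exact: emeasurable_funD.
  - exact: ltW.
  apply: ge0_le_integral.
  - exact: mB.
  - by move=> x _; rewrite lee_fin osc_bound_ge0.
  - by apply/measurable_EFinP; apply: measurable_funTS; exact: measurable_osc_bound.
  - apply: measurable_funeM; exact: emeasurable_funD.
  move=> x _; rewrite -EFinD -EFinM lee_fin /osc_bound ler_wpM2l ?(ltW Ks)//=.
  set y := _ * _; have y0 : 0 <= y by rewrite mulr_ge0 ?energy_ge0// ltW.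
  have [y1|y1] := leP y 1.
    rewrite ler_wpDr// -[leRHS](_ : 1 `^ p^-1 = 1); last by rewrite powR1.
    by apply: ge0_ler_powR => //; rewrite ?nnegrE// invr_ge0 ltW.
  rewrite ler_wpDl// -[leRHS](powRr1 y0) ler_powR ?(ltW y1)//.
  by rewrite invf_le1.
rewrite ge0_integralD; last 5 first.
- exact: mB.
- by move=> x _; exact: lee01.
- exact: m1.
- by move=> x _; exact: pE.
- exact: mE.
rewrite (_ : K * _ * s = K * s * (C * t `^ Q + B)); last by ring.
rewrite [leRHS]EFinM lee_wpmul2l ?lee_fin ?(ltW Ks)// EFinD leeD//.
  by rewrite integral_cst// mul1e; exact: up.
under eq_integral do rewrite EFinM.
rewrite ge0_integralZl_EFin; last 4 first.
- exact: mB.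
- by move=> x _; rewrite lee_fin energy_ge0.
- by apply/measurable_EFinP; apply: measurable_funTS; exact: measurable_energy.
- exact: ltW.
have := integral_energy_le x0 s0 t0; rewrite -/B => /(lee_wpmul2l _).
move=> /(_ (s `^ (- Q))%:E); rewrite lee_fin (ltW sQ) => /(_ isT) /le_trans; apply.
rewrite -EFinM lee_fin powRN mulrCA mulVf ?mulr1// gt_eqF//.
by rewrite powR_gt0.
Qed.

Let radius s n : R := s * 2^-1 ^+ n.

(** The errors at the radii s / 2^n have integrals O(2^-n), so their sum is
integrable, hence finite almost everywhere. *)
Lemma ball_mean_cvg_ae (x0 : X) t s : 0 < t -> 0 < s -> regular_radius (X := X) s ->
  {ae m, forall x, ball x0 t x -> (fun n => F (radius s n) x) @ \oo --> f x}.
Proof.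
move=> t0 s0 rs.
have [c c0 Hc] := integral_osc_le.
have [M M0 HM] := integral_osc_bound_le x0 (addr_gt0 t0 s0).
pose d n x : \bar R := `|f x - F (radius s n.+1) x|%:E.
have md n : measurable_fun (ball x0 t : set T) (d n).
  apply/measurable_EFinP; apply: measurableT_comp => //.
  by apply: measurable_funTS; apply: measurable_funB => //; exact: measurable_ball_mean.
have r0 n : 0 < radius s n by rewrite mulr_gt0// exprn_gt0.
have rS n : 2 * radius s n.+1 = radius s n by rewrite /radius exprS; field.
have r_le n : radius s n <= s.
  by rewrite ler_piMr ?(ltW s0)// exprn_ile1// invf_le1// ler1n.
have dle n : (\int[m]_(x in ball x0 t) d n x <= (c * M * s * 2^-1 ^+ n)%:E)%E.
  have := Hc x0 t (radius s n.+1) t0 (r0 _); rewrite rS.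
  move=> /(_ (regular_radius_le (r_le n) rs)) /le_trans; apply.
  rewrite -!mulrA [leRHS]EFinM lee_wpmul2l ?lee_fin//.
  apply: le_trans (HM _ (r0 n)); apply: ge0_subset_integral => //.
  - by apply/measurable_EFinP; apply: measurable_funTS; exact: measurable_osc_bound.
  - by move=> x _; rewrite lee_fin osc_bound_ge0.
  - by apply: le_ball; rewrite lerD2l.
have sum_lty : (\int[m]_(x in ball x0 t) \sum_(0 <= n <oo) d n x < +oo)%E.
  rewrite integral_nneseries; last 3 first.
  - exact: mB.
  - exact: md.
  - by move=> n x _; rewrite lee_fin.
  apply: (@le_lt_trans _ _ (\sum_(0 <= n <oo) (c * M * s * 2^-1 ^+ n)%:E)%E).
    apply: lee_nneseries => [n _ _|n _]; last exact: dle.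
    by apply: integral_ge0 => x _; rewrite lee_fin.
  apply: le_lt_trans (eseries_geometric_le _ _ _) (ltry _) => //.
  - by rewrite !mulr_ge0// ltW.
  - by rewrite invf_lt1// ltr1n.
have : m.-integrable (ball x0 t) (fun x => \sum_(0 <= n <oo) d n x)%E.
  apply/integrableP; split.
    by apply: ge0_emeasurable_sum => // n x _ _; rewrite lee_fin.
  rewrite (eq_integral (fun x => \sum_(0 <= n <oo) d n x)%E); first exact: sum_lty.
  by move=> x _; rewrite gee0_abs//; apply: nneseries_ge0 => n _ _; rewrite lee_fin.
move=> /(integrable_ae (mB _ _)); apply: filterS => x H Bx.
have {}H : (\sum_(0 <= n <oo) d n x < +oo)%E.
  rewrite -ge0_fin_numE; [exact: H Bx|by apply: nneseries_ge0 => n _ _; rewrite lee_fin].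
have d0 k : (0 <= d k x)%E by rewrite lee_fin.
have tail := nneseries_tail_cvg H (fun k _ => d0 k).
have dx0 : d ^~ x @ \oo --> 0%E.
  apply: (squeeze_cvge _ _ tail); last exact: cvg_cst.
  apply: nearW => n; rewrite d0/=.
  apply: le_trans (nneseries_lim_ge n.+1 _); last by move=> *; exact: d0.
  by rewrite big_nat1.
have : (fun n => `|f x - F (radius s n.+1) x|) @ \oo --> 0.
  exact: (fine_cvg dx0).
move=> /norm_cvg0P h0; rewrite -(cvg_shiftS (fun n => F (radius s n) x)).
have : (fun n => f x - (f x - F (radius s n.+1) x)) @ \oo --> f x - 0.
  by apply: cvgB h0; exact: cvg_cst.
rewrite subr0; apply: cvg_trans; apply: near_eq_cvg; apply: nearW => n.
by rewrite opprB addrC subrK.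
Qed.

Variable Qs : R.
Hypothesis Qs1 : 1 <= Qs.
Let a := Q * (1 - e).
Let P := Qs * p.

(** [gain] is the power of the radius that is left once the energy, raised to
the power [Qs], has been bounded by its supremum in all factors but one. *)
Definition gain := P - Q * e * (Qs - 1).
Hypothesis gain_gt0 : 0 < gain.

Definition halving_const :=
  (C ^+ 2 * 2 `^ Q * K) `^ P * tau `^ (a * (Qs - 1)) * (C * 2 `^ a * tau `^ Q).

Let Qs0 : 0 < Qs. Proof. by rewrite (lt_le_trans _ Qs1). Qed.
Let P0 : 0 < P. Proof. by rewrite mulr_gt0. Qed.

(** The increment is at most a multiple of [osc_bound], whose P-th power is the
energy to the power [Qs]: the supremum of the energy bounds [Qs - 1] of these
factors and the integral of the energy takes care of the last one. *)
Lemma integral_halving_le x0 t s : 0 < t -> 0 < s -> regular_radius (X := X) s ->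
  (\int[m]_(x in ball x0 t) (`|F (s * 2^-1) x - F s x| `^ P)%:E <=
   (halving_const * (A `^ Qs * t `^ a * s `^ gain))%:E)%E.
Proof.
move=> t0 s0 rs; set c := C ^+ 2 * 2 `^ Q.
have c0 : 0 <= c by rewrite mulr_ge0 ?powR_ge0// exprn_ge0 ?(ltW C0).
have s2 : 2 * (s * 2^-1) = s by rewrite mulrC divfK.
have mE : measurable_fun (ball x0 t : set T) (fun x => (energy s x)%:E).
  by apply/measurable_EFinP; apply: measurable_funTS; exact: measurable_energy.
pose b := (c * K) `^ P * s `^ P * s `^ (- Q * Qs) * (A * (tau * s) `^ a) `^ (Qs - 1).
have b0 : 0 <= b by rewrite !mulr_ge0 ?powR_ge0.
apply: (@le_trans _ _ (b%:E * \int[m]_(x in ball x0 t) (energy s x)%:E)%E).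
  rewrite -ge0_integralZl_EFin; last 4 first.
  - exact: mB.
  - by move=> x _; rewrite lee_fin energy_ge0.
  - exact: mE.
  - exact: b0.
  apply: ge0_le_integral.
  - exact: mB.
  - by move=> x _; rewrite lee_fin powR_ge0.
  - exact: measurable_norm_sub_powR (measurable_ball_mean _) (measurable_ball_mean _).
  - exact: measurable_funeM.
  move=> x _; rewrite -EFinM lee_fin.
  have w0 := energy_ge0 s x.
  apply: (@le_trans _ _ ((c * osc_bound s x) `^ P)).
    apply: ge0_ler_powR; first exact: ltW.
    - exact: normr_ge0.
    - exact: mulr_ge0 c0 (osc_bound_ge0 x s0).
    have := @ball_mean_near (s * 2^-1) x x; rewrite s2 mdistxx; apply => //.
      by rewrite divr_gt0.
    by rewrite ltW// divr_gt0.
  have -> : (c * osc_bound s x) `^ P =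
      (c * K) `^ P * s `^ P * s `^ (- Q * Qs) * energy s x `^ Qs.
    rewrite /osc_bound !mulrA powRM ?powR_ge0 ?(mulr_ge0 (mulr_ge0 c0 (ltW K0)) (ltW s0))//.
    rewrite (powRM _ (mulr_ge0 c0 (ltW K0)) (ltW s0)) -powRrM.
    have -> : p^-1 * P = Qs by rewrite /P; field; rewrite gt_eqF.
    by rewrite (powRM _ (powR_ge0 _ _) w0) -powRrM !mulrA.
  have -> : energy s x `^ Qs = energy s x `^ (Qs - 1) * energy s x.
    by rewrite -[X in _ * X](powRr1 w0) -powRD ?subrK// gt_eqF.
  rewrite /b mulrA ler_wpM2r// ler_wpM2l ?mulr_ge0 ?powR_ge0//.
  apply: ge0_ler_powR; rewrite ?nnegrE ?subr_ge0//.
    by rewrite mulr_ge0 ?powR_ge0.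
  exact: energy_le.
apply: (@le_trans _ _ (b%:E * (C * A * 2 `^ a * tau `^ Q * t `^ a * s `^ Q)%:E)%E).
  by rewrite lee_wpmul2l ?lee_fin//; exact: integral_energy_le.
rewrite -EFinM lee_fin le_eqVlt; apply/orP; left; apply/eqP.
have sE : s `^ gain = s `^ P * s `^ (- Q * Qs) * s `^ (a * (Qs - 1)) * s `^ Q.
  rewrite -!powRD ?(gt_eqF s0) ?implybT//; congr (_ `^ _).
  by rewrite /gain /a; ring.
have AE : A `^ Qs = A `^ (Qs - 1) * A.
  rewrite -[X in _ * X](powRr1 A0) -powRD ?subrK// gt_eqF//.
rewrite /halving_const /b -/c sE AE.
rewrite (powRM _ A0) ?powR_ge0// -powRrM (powRM _ (ltW tau0) (ltW s0)).
by ring.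
Qed.

(* Half of the geometric decay of the increments is spent on the weights of
   telescope_powR_le, the other half makes the resulting series converge. *)
Let eta := 2^-1 `^ (gain / 2).

Definition sub_mean_const :=
  (1 - eta `^ P^-1)^-1 `^ P * (halving_const * (1 - eta)^-1).

Let eta0 : 0 < eta. Proof. by rewrite powR_gt0. Qed.
Let eta1 : eta < 1.
Proof.
have <- : 1 `^ (gain / 2) = 1 :> R by rewrite powR1.
apply: gt0_ltr_powR; rewrite ?divr_gt0 ?nnegrE//.
by rewrite invf_lt1// ltr1n.
Qed.

Let halving_const_ge0 : 0 <= halving_const.
Proof. by rewrite !mulr_ge0 ?powR_ge0 ?(ltW C0). Qed.

Lemma integral_sub_mean_le (x0 : X) t s : 0 < t -> 0 < s -> regular_radius (X := X) s ->
  (\int[m]_(x in ball x0 t) (`|f x - F s x| `^ P)%:E <=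
   (sub_mean_const * (A `^ Qs * t `^ a * s `^ gain))%:E)%E.
Proof.
move=> t0 s0 rs.
pose v k x := (`|F (radius s k.+1) x - F (radius s k) x| `^ P * eta^-1 ^+ k)%:E.
set B := A `^ Qs * t `^ a * s `^ gain.
have B0 : 0 <= B by rewrite !mulr_ge0 ?powR_ge0.
have r0 n : 0 < radius s n by rewrite mulr_gt0// exprn_gt0.
have r_le n : radius s n <= s.
  by rewrite ler_piMr ?(ltW s0)// exprn_ile1// invf_le1// ler1n.
have ek k : 0 <= eta^-1 ^+ k by rewrite exprn_ge0// invr_ge0 ltW.
have v0 k x : (0 <= v k x)%E by rewrite lee_fin mulr_ge0 ?powR_ge0.
have mh k : measurable_fun (ball x0 t : set T)
    (fun x => (`|F (radius s k.+1) x - F (radius s k) x| `^ P)%:E).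
  exact: measurable_norm_sub_powR (measurable_ball_mean _) (measurable_ball_mean _).
have mv k : measurable_fun (ball x0 t : set T) (v k).
  rewrite /v; under eq_fun do rewrite EFinM muleC.
  exact: measurable_funeM.
have mS : measurable_fun (ball x0 t : set T) (fun x => \sum_(0 <= k <oo) v k x)%E.
  by apply: ge0_emeasurable_sum => // k x _ _; exact: v0.
have iP : 0 <= (1 - eta `^ P^-1)^-1 `^ P by exact: powR_ge0.
apply: (@le_trans _ _ (((1 - eta `^ P^-1)^-1 `^ P)%:E *
    \int[m]_(x in ball x0 t) \sum_(0 <= k <oo) v k x)%E).
  have S0 x : (0 <= \sum_(0 <= k <oo) v k x)%E.
    by apply: nneseries_ge0 => k _ _; exact: v0.
  rewrite -ge0_integralZl_EFin; last 4 first.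
  - exact: mB.
  - by move=> x _; exact: S0.
  - exact: mS.
  - exact: iP.
  apply: ae_ge0_le_integral.
  - exact: mB.
  - by move=> x _; rewrite lee_fin powR_ge0.
  - exact: measurable_norm_sub_powR mf (measurable_ball_mean s).
  - by move=> x _; rewrite mule_ge0 ?lee_fin.
  - exact: measurable_funeM.
  have [N [mN N0 NF]] := ball_mean_cvg_ae x0 t0 s0 rs.
  exists N; split => // x H; apply: NF; apply: contra_not H => /= + Bx.
  move=> /(_ Bx) cvgF; have := telescope_powR_le P0 eta0 eta1 cvgF.
  by rewrite /= {1}/radius expr0 mulr1.
rewrite integral_nneseries; last 3 first.
- exact: mB.
- exact: mv.
- by move=> k x _; exact: v0.
rewrite /sub_mean_const -(mulrA (_ `^ P)) EFinM.
rewrite lee_wpmul2l ?lee_fin//.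
rewrite (_ : halving_const * _ * _ = halving_const * B * (1 - eta)^-1); last by ring.
apply: le_trans (eseries_geometric_le _ eta0 eta1); last by rewrite mulr_ge0.
apply: lee_nneseries => [k _ _|k _]; first exact: integral_ge0.
rewrite /v; under eq_integral do rewrite mulrC EFinM.
rewrite ge0_integralZl_EFin; last 4 first.
- exact: mB.
- by move=> x _; rewrite lee_fin powR_ge0.
- exact: mh.
- exact: ek.
have rSk : radius s k.+1 = radius s k * 2^-1 by rewrite /radius exprSr mulrA.
have := integral_halving_le x0 t0 (r0 k) (regular_radius_le (r_le k) rs).
rewrite -rSk => /(lee_wpmul2l (_ : 0 <= (eta^-1 ^+ k)%:E)%E).
rewrite lee_fin => /(_ (ek k)) /le_trans; apply.
rewrite -EFinM lee_fin.
have -> : radius s k `^ gain = s `^ gain * (eta * eta) ^+ k.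
  rewrite /radius powRM ?(ltW s0) ?exprn_ge0//; congr (_ * _).
  rewrite -powRD ?pnatr_eq0 ?invr_eq0 ?pnatr_eq0 ?implybT// -splitr.
  have h2 : 0 <= 2^-1 :> R by rewrite invr_ge0.
  by rewrite -(powR_mulrn k h2) -(powR_mulrn k (powR_ge0 _ _)); exact: powRAC.
rewrite le_eqVlt; apply/orP; left; apply/eqP.
rewrite exprMn exprVn /B; field.
by rewrite expf_neq0// gt_eqF.
Qed.

End estimates.

(** * Morrey norms and the theorem *)

Section morrey.
Context {R : realType} {X : pointedMetricType R}.
Variable mu : {outer_measure set X -> \bar R}.
Hypothesis mms : metric_measure_space mu.
Local Notation T := (caratheodory_type mu).
Local Notation m := (cara mu).

Lemma morrey_norm_ge0 p q (u : X -> \bar R) : (0 <= morrey_norm mu p q u)%E.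
Proof.
apply: (@le_trans _ _ (mu (ball point 1) `^ (q^-1 - p^-1)
  * (\int[m]_(y in ball point 1) `|u y| `^ p) `^ p^-1)%E).
  by rewrite mule_ge0 ?poweR_ge0.
by rewrite /morrey_norm; apply: ereal_sup_ubound; exists (point, 1) => //=.
Qed.

Lemma integral_ball_le_morrey Q C p q N (u : X -> \bar R) :
  ahlfors_bounds mu Q C -> 0 < p -> p <= q -> 0 <= N ->
  (morrey_norm mu p q u <= N%:E)%E -> forall (x : X) t, 0 < t ->
  (\int[m]_(y in ball x t) `|u y| `^ p <=
    (N `^ p * C `^ (1 - p / q) * t `^ (Q * (1 - p / q)))%:E)%E.
Proof.
move=> [C1 up _] p0 pq N0 uN x t t0.
have q0 : 0 < q by exact: lt_le_trans pq.
have C0 : 0 < C by rewrite (lt_le_trans _ C1).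
have := mu_ball_fin mms x t; have := mu_ball_gt0 mms x t0; have := up x t t0.
have : (mu (ball x t) `^ (q^-1 - p^-1)
      * (\int[m]_(y in ball x t) `|u y| `^ p) `^ p^-1 <= N%:E)%E.
  apply: le_trans uN; rewrite /morrey_norm.
  by apply: ereal_sup_ubound; exists (x, t).
have : (0 <= \int[m]_(y in ball x t) `|u y| `^ p)%E.
  by apply: integral_ge0 => y _; exact: poweR_ge0.
case: (mu (ball x t)) => [b| |]//.
set a := q^-1 - p^-1; move: (\int[m]_(y in _) _)%E => I I0 + + + _.
rewrite lee_fin lte_fin => + bC b0; rewrite poweR_EFin.
have ba0 : 0 < b `^ a by rewrite powR_gt0.
case: I I0 => [I| |]//; last first.
  by move=> _; rewrite poweRyr ?invr_neq0 ?gt_eqF// gt0_muley// leye_eq.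
rewrite lee_fin => I0; rewrite poweR_EFin -EFinM !lee_fin -ler_pdivlMl// => IN.
have {}IN : (I `^ p^-1) `^ p <= ((b `^ a)^-1 * N) `^ p.
  apply: ge0_ler_powR IN; rewrite ?nnegrE ?powR_ge0 ?(ltW p0)//.
  by rewrite mulr_ge0// invr_ge0 ltW.
move: IN; rewrite -powRrM mulVf ?gt_eqF// powRr1// => /le_trans; apply.
rewrite -powRN powRM ?powR_ge0// -powRrM mulrC -mulrA ler_wpM2l ?powR_ge0//.
have -> : - a * p = 1 - p / q by rewrite /a; field; rewrite !gt_eqF.
have e0 : 0 <= 1 - p / q by rewrite subr_ge0 ler_pdivrMr ?mul1r.
rewrite powRrM -powRM ?(ltW C0) ?powR_ge0//.
by apply: ge0_ler_powR => //; rewrite nnegrE ?mulr_ge0 ?powR_ge0 ?(ltW C0) ?(ltW b0).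
Qed.

(** Balls have finite measure and |f| <= 1 + |f|^p. *)
Lemma integrable_ball_morrey p q (f : X -> R) (x : X) t : 1 <= p -> p <= q ->
  mu_measurable_fun mu setT f -> (morrey_norm mu p q (EFin \o f) < +oo)%E ->
  m.-integrable (ball x t) (EFin \o f).
Proof.
move=> p1 pq mf fM.
have p0 : 0 < p by exact: lt_le_trans p1.
have q0 : 0 < q by exact: lt_le_trans pq.
have mB := measurable_mball mms x t.
have mfB : measurable_fun (ball x t : set T) (f : T -> R).
  exact: (@measurable_funTS _ _ T _ _ _ mf).
have mEf : measurable_fun (ball x t : set T) (EFin \o f) by exact/measurable_EFinP.
apply/integrableP; split; first exact: mEf.
have [t0|t0] := leP t 0.
  rewrite (_ : ball x t = set0) ?integral_set0//.
  apply/seteqP; split => // y /ball_mdist /lt_le_trans /(_ t0).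
  by rewrite ltNge mdist_ge0.
pose g : T -> \bar R := fun y => (`|(EFin \o f) y| `^ p)%E.
have mg : measurable_fun (ball x t : set T) g.
  apply: (measurableT_comp (measurable_poweR p)).
  exact: (measurableT_comp (@abse_measurable R setT) mEf).
apply: (@le_lt_trans _ _ (\int[m]_(y in ball x t) (cst 1%E y + g y))%E).
  apply: ge0_le_integral.
  - exact: mB.
  - by move=> y _; exact: abse_ge0.
  - exact: (measurableT_comp (@abse_measurable R setT) mEf).
  - by apply: emeasurable_funD mg; exact: measurable_cst.
  move=> y _; rewrite /g /=. rewrite lee_fin.
  have [y1|y1] := leP `|f y| 1; first by rewrite ler_wpDr// powR_ge0.
  by rewrite ler_wpDl// -[leLHS]powRr1// ler_powR// ltW.
rewrite ge0_integralD; last 5 first.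
- exact: mB.
- by move=> y _; exact: lee01.
- exact: measurable_cst.
- by move=> y _; exact: poweR_ge0.
- exact: mg.
rewrite integral_cst// mul1e lte_add_pinfty ?mu_ball_lty//.
have := fM; have : (mu (ball x t) `^ (q^-1 - p^-1)
      * (\int[m]_(y in ball x t) g y) `^ p^-1 <= morrey_norm mu p q (EFin \o f))%E.
  by rewrite /morrey_norm; apply: ereal_sup_ubound; exists (x, t).
move=> /le_lt_trans /[apply].
have : (0 < mu (ball x t) `^ (q^-1 - p^-1))%E by rewrite poweR_gt0// mu_ball_gt0.
case: (\int[m]_(y in _) _)%E => [I| |]//; first by rewrite ltry.
by move=> b0; rewrite poweRyr ?invr_neq0 ?gt_eqF// gt0_muley.
Qed.

End morrey.

Lemma pre_NM_morrey_lty (R : realType) (X : pointedMetricType R)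
    (mu : {outer_measure set X -> \bar R}) p q (f : X -> R) :
  pre_NM mu p q f -> (morrey_norm mu p q (EFin \o f) < +oo)%E.
Proof.
move=> [_]; rewrite /pre_NM_norm => /(le_lt_trans _); apply.
rewrite leeDl//; apply: le_ereal_inf_tmp => _ [g _ <-].
exact: morrey_norm_ge0.
Qed.

Section one_point.
Context {R : realType} {X : pointedMetricType R}.
Variable mu : {outer_measure set X -> \bar R}.
Hypothesis mms : metric_measure_space mu.
Hypothesis one_point : forall x y : X, x = y.

Lemma mean_one_point (f : X -> R) (x : X) s : 0 < s -> mean mu (ball x s) f = f x.
Proof.
move=> s0; rewrite /mean.
rewrite (@eq_Rintegral _ _ _ _ _ (cst (f x))); last first.
  by move=> y _ /=; rewrite (one_point y x).
rewrite Rintegral_cst; last exact: measurable_mball.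
have B0 : 0 < fine (mu (ball x s)) by rewrite fine_gt0// mu_ball_gt0// mu_ball_lty.
by rewrite mulrCA mulVf ?mulr1// gt_eqF.
Qed.

Lemma morrey_norm_sub_mean_one_point p q (f : X -> R) s : 0 < s -> 0 < p ->
  morrey_norm mu p q (fun x => (f x - mean mu (ball x s) f)%:E) = 0%E.
Proof.
move=> s0 p0; apply/eqP; rewrite eq_le morrey_norm_ge0 andbT.
apply: ge_ereal_sup => _ [[x t] /= t0 <-].
rewrite integral0_eq ?poweR0r ?mule0 ?invr_neq0 ?gt_eqF// => y _.
by rewrite /= mean_one_point// subrr normr0 powR0// gt_eqF.
Qed.
End one_point.

(** The algebra by which the P-th root of the estimate of [integral_sub_mean_le]
becomes linear in the Morrey norm [N]. *)
Lemma powR_root_collect (R : realType) (k N C t s p Qs a b g : R) :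
  0 <= k -> 0 <= N -> 0 < p -> 0 < Qs ->
  (k * ((N `^ p * C `^ b) `^ Qs * t `^ a * s `^ (Qs * p * g))) `^ (Qs * p)^-1 =
  k `^ (Qs * p)^-1 * (N * C `^ (b / p)) * t `^ (a / (Qs * p)) * s `^ g.
Proof.
move=> k0 N0 p0 Qs0; set P := (Qs * p)^-1.
have pw (x y : R) : 0 <= x `^ y by exact: powR_ge0.
have X0 : 0 <= (N `^ p * C `^ b) `^ Qs by exact: powR_ge0.
rewrite (powRM _ k0 (mulr_ge0 (mulr_ge0 X0 (pw t a)) (pw s _))).
rewrite (powRM _ (mulr_ge0 X0 (pw t a)) (pw s _)) (powRM _ X0 (pw t a)).
rewrite -(powRrM _ Qs) (powRM _ (pw N p) (pw C b)) -!powRrM.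
have -> : p * (Qs * P) = 1 by rewrite /P; field; rewrite !gt_eqF.
have -> : b * (Qs * P) = b / p by rewrite /P; field; rewrite !gt_eqF.
have -> : Qs * p * g * P = g by rewrite /P; field; rewrite !gt_eqF.
by rewrite powRr1// !mulrA.
Qed.

Theorem theorem3p6 (R : realType) (X : pointedMetricType R)
    (mu : {outer_measure set X -> \bar R}) (r p q Q alpha : R) :
  metric_measure_space mu ->
  1 <= r -> r < p -> p <= q ->
  0 < Q ->
  0 < alpha -> alpha < r -> alpha < Q ->
  1 < p / r -> p / r <= q / r -> q / r < Q / alpha ->
  ahlfors_regular mu Q ->
  weak_poincare mu r ->
  let Qstar := Q * r / (Q * r - q * alpha) in
  exists2 C : R, 0 < C &
    forall u : set (X -> R), NM mu p q u ->
    forall f : X -> R, u f ->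
    forall rho : X -> \bar R, upper_gradient_in mu setT f rho ->
    forall s : R, 0 < s ->
      (morrey_norm mu (Qstar * p) (Qstar * q)
         (fun x => (f x - mean mu (ball x s) f)%:E)
       <= (C * s `^ (1 - alpha / r))%:E * morrey_norm mu p q rho)%E.
Proof.
move=> mms r1 rp pq Q0 al0 alr _ _ _ qQ ahl poin Qs.
have r0 : 0 < r by rewrite (lt_le_trans _ r1).
have p1 : 1 <= p by rewrite (le_trans r1)// ltW.
have p0 : 0 < p by rewrite (lt_le_trans _ p1).
have q0 : 0 < q by rewrite (lt_le_trans _ pq).
have den0 : 0 < Q * r - q * alpha.
  by move: qQ; rewrite subr_gt0 ltr_pdivrMr// mulrAC ltr_pdivlMr.
have qal0 : 0 < q * alpha by rewrite mulr_gt0.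
have Qs1 : 1 <= Qs.
  by rewrite /Qs ler_pdivlMr// mul1r lerBlDr lerDl ltW.
have Qs0 : 0 < Qs by rewrite (lt_le_trans _ Qs1).
have P0 : 0 < Qs * p by rewrite mulr_gt0.
have be0 : 0 < 1 - alpha / r by rewrite subr_gt0 ltr_pdivrMr ?mul1r.
(* On a one-point space no radius is regular, but f equals its means. *)
have [D0|D0] := eqVneq (ediam [set: X]) 0%E.
  exists 1 => // u _ f _ rho _ s s0.
  rewrite morrey_norm_sub_mean_one_point//; last exact: ediam_eq0.
  by rewrite mule_ge0 ?morrey_norm_ge0// lee_fin mul1r powR_ge0.
have {}D0 : (0 < ediam [set: X])%E by rewrite lt_def D0 ediam_ge0.
have [C AB] := ahlfors_regular_bounds D0 Q0 ahl.
have [C1 _ lo] := AB; have C0 : 0 < C by rewrite (lt_le_trans _ C1).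
have [K [tau [K0 tau1 PI]]] := weak_poincare_energy mms Q0 AB r1 rp poin.
pose e := p / q.
have e0 : 0 < e by rewrite divr_gt0.
have e1 : e <= 1 by rewrite ler_pdivrMr ?mul1r.
have gainE : gain Q p e Qs = (Qs * p) * (1 - alpha / r).
  by rewrite /gain /e /Qs; field; rewrite !gt_eqF.
have gain0 : 0 < gain Q p e Qs by rewrite gainE mulr_gt0.
(* The absolute value and the 1 make the constant visibly positive. *)
pose k := `|sub_mean_const Q C p e K tau Qs| + 1.
have k0 : 0 < k by rewrite ltr_wpDl.
pose c1 := k `^ (Qs * p)^-1 * C `^ ((1 - e) / p).
pose c2 := C `^ ((1 - e) / (Qs * p)).
exists (c2 * c1); first by rewrite !mulr_gt0 ?powR_gt0.
move=> _ [h hNM <-] f [fNM _] rho ug s s0.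
have [mf mrho rho0 _] := ug.
have {hNM}fM := pre_NM_morrey_lty fNM.
have sb0 : 0 < s `^ (1 - alpha / r) by rewrite powR_gt0.
have := morrey_norm_ge0 mu p q rho.
case rhoE : (morrey_norm mu p q rho) => [N| |] N0 //; last first.
  by rewrite gt0_muley ?leey// lte_fin !mulr_gt0 ?powR_gt0.
rewrite lee_fin in N0.
pose g : caratheodory_type mu -> \bar R := fun y => (rho y `^ p)%E.
have mg : measurable_fun setT g.
  apply: (measurableT_comp (measurable_poweR p)).
  by apply: borel_measurable_cara.
have g0 y : (0 <= g y)%E by exact: poweR_ge0.
pose A := N `^ p * C `^ (1 - e).
have A0 : 0 <= A by rewrite mulr_ge0 ?powR_ge0.
have gA x t : 0 < t ->
    (\int[cara mu]_(y in ball x t) g y <= (A * t `^ (Q * (1 - e)))%:E)%E.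
  move=> t0.
  have := integral_ball_le_morrey (u := rho) mms AB p0 pq N0 _ x t0.
  rewrite rhoE lexx => /(_ isT); apply: le_trans.
  rewrite le_eqVlt; apply/orP; left; apply/eqP; apply: eq_integral => y _.
  by rewrite gee0_abs// rho0.
have If x t := integrable_ball_morrey mms x t p1 pq mf fM.
have osc x t : 0 < t -> regular_radius (X := X) t ->
    (\int[cara mu]_(y in ball x t) `|f y - ball_mean (mu := mu) f t x|%:E <=
     (osc_bound (mu := mu) Q p K tau g t x)%:E * mu (ball x t))%E.
  move=> t0 rt; apply: (PI f rho x t _ t0 rt ug (If x t)).
    exact: energy_ge0.
  by rewrite (energyE tau1 g0 gA).
have [s' [s'0 s's rs' Bs']] := ball_regular_radius D0 s0.
rewrite (_ : (fun x => _) = fun x => (f x - mean mu (ball x s') f)%:E); last first.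
  by apply/funext => x; rewrite Bs'.
apply: ge_ereal_sup => _ [[x t0] /= t00 <-].
have [t [t_gt0 _ rt <-]] := ball_regular_radius D0 t00.
have main := integral_sub_mean_le mms Q0 AB p1 e0 e1 K0 tau1 mg g0 A0 gA mf If osc
  Qs1 gain0 x t_gt0 s'0 rs'.
set I := (\int[cara mu]_(y in ball x t) _)%E.
set B := A `^ Qs * t `^ (Q * (1 - e)) * s' `^ gain Q p e Qs in main.
have B0 : 0 <= B by rewrite !mulr_ge0 ?powR_ge0.
have {}main : (I <= (k * B)%:E)%E.
  apply: (le_trans main).
  by rewrite lee_fin ler_wpM2r// (le_trans (ler_norm _))// lerDl.
have I0 : (0 <= I)%E by apply: integral_ge0 => y _; rewrite lee_fin powR_ge0.
have {}main : (I `^ (Qs * p)^-1 <= ((k * B) `^ (Qs * p)^-1)%:E)%E.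
  rewrite -poweR_EFin; apply: gt0_ler_poweR => //.
  - by rewrite invr_ge0 ltW.
  - by rewrite in_itv/= leey andbT.
  - by rewrite in_itv/= leey andbT lee_fin mulr_ge0// ltW.
have aE : (Qs * q)^-1 - (Qs * p)^-1 = - ((1 - e) / (Qs * p)).
  by rewrite /e; field; rewrite !gt_eqF.
have muB : (mu (ball x t) `^ ((Qs * q)^-1 - (Qs * p)^-1) <=
    (c2 * t `^ (- (Q * (1 - e) / (Qs * p))))%:E)%E.
  rewrite aE.
  have := lo x t t_gt0 rt; rewrite -(fineK (mu_ball_fin mms x t)).
  rewrite poweR_EFin !lee_fin => lo_t.
  have l0 : 0 < C^-1 * t `^ Q by rewrite mulr_gt0 ?invr_gt0 ?powR_gt0.
  have a0 : 0 <= (1 - e) / (Qs * p) by rewrite divr_ge0 ?subr_ge0// ltW.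
  rewrite (powRN t) (powRN (fine _)) (_ : c2 * _ = ((C^-1 * t `^ Q) `^ ((1 - e) / (Qs * p)))^-1).
    rewrite lef_pV2 ?posrE ?powR_gt0 ?(lt_le_trans l0)//.
    by apply: ge0_ler_powR; rewrite ?nnegrE ?(ltW l0)// (le_trans (ltW l0)).
  rewrite /c2 -(mulrA Q); set a := (1 - e) / (Qs * p).
  rewrite powRM ?powR_ge0 ?invr_ge0 ?(ltW C0)// invfM -powRrM; congr (_ * _).
  by rewrite -(powR_inv1 (ltW C0)) -powRrM mulN1r powRN invrK.
apply: le_trans (lee_pmul (poweR_ge0 _ _) (poweR_ge0 _ _) muB main) _.
rewrite -!EFinM lee_fin.
have -> : (k * B) `^ (Qs * p)^-1 =
    c1 * N * t `^ (Q * (1 - e) / (Qs * p)) * s' `^ (1 - alpha / r).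
  by rewrite /B /A gainE powR_root_collect ?(ltW k0)// /c1 (mulrC N) !mulrA.
have tt : t `^ (- (Q * (1 - e) / (Qs * p))) * t `^ (Q * (1 - e) / (Qs * p)) = 1.
  by rewrite -powRD ?addNr ?powRr0// (gt_eqF t_gt0) implybT.
have cancel_pow (a b c d y z : R) : y * z = 1 -> a * y * (b * c * z * d) = a * b * d * c.
  by move=> yz; rewrite -[RHS]mul1r -yz; ring.
rewrite (cancel_pow _ _ _ _ _ _ tt).
rewrite ler_wpM2r// ler_wpM2l ?mulr_ge0 ?powR_ge0//.
by apply: ge0_ler_powR; rewrite ?nnegrE ?(ltW be0) ?(ltW s'0) ?(ltW s0).
Qed.
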